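(* Let $L$ be a locally compact Hausdorff space. Then the Banach space $C_0(L)$ has the BPBp-nu for compact operators.
   Context: Banach spaces are over $\mathbb{K}=\mathbb{R}$ or $\mathbb{C}$. $C_0(L)$ is the Banach space of all $\mathbb{K}$-valued continuous functions on $L$ vanishing at infinity, with the supremum norm. For a Banach space $X$, $S_X$ is its unit sphere, $X^*$ its dual, $\mathcal{K}(X)$ the space of compact linear operators from $X$ to $X$, and $\Pi(X)=\{(x,x^* )\in S_X\times S_{X^*}: x^*(x)=1\}$. The numerical radius of a bounded linear operator $T$ on $X$ is $\nu(T)=\sup\{|x^*(T(x))|:(x,x^* )\in\Pi(X)\}$. A Banach space $X$ has the Bishop-Phelps-Bollobás property for numerical radius for compact operators (BPBp-nu for compact operators) if for every $0<\varepsilon<1$ there exists $\eta(\varepsilon)\in(0,1)$ such that whenever $T\in\mathcal{K}(X)$ and $(x,x^* )\in\Pi(X)$ satisfy $\nu(T)=1$ and $|x^*(T(x))|>1-\eta(\varepsilon)$, there exist $S\in\mathcal{K}(X)$ and $(y,y^* )\in\Pi(X)$ such that $\nu(S)=|y^*(S(y))|=1$, $\|T-S\|<\varepsilon$, $\|x-y\|<\varepsilon$ and $\|x^*-y^*\|<\varepsilon$. *)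

(* Defs.v *)
From HB Require Import structures.
From mathcomp Require Import all_boot all_order all_algebra.
From mathcomp Require Import complex.
From mathcomp Require Import all_classical all_reals all_analysis.

Set Implicit Arguments.
Unset Strict Implicit.
Unset Printing Implicit Defensive.

Import Order.TTheory GRing.Theory Num.Theory.
Import numFieldNormedType.Exports.

Local Open Scope classical_set_scope.
Local Open Scope ring_scope.

(* The field of scalars is either R or R[i].  Norms of normed modules over K
   take their values in K; since 0 < eps in K forces eps to be real, quantifying
   over eps : K with 0 < eps quantifies over real numbers also when K = R[i]. *)
Variant scalar_kind := RealScalars | ComplexScalars.

Definition scalars (R : realType) (k : scalar_kind) : numFieldType :=
  match k with RealScalars => R | ComplexScalars => R[i] end.

(* [supremum 0 A] is the least upper bound of A : set K if there is one and 0
   otherwise (in particular if A is empty).  It is only applied to sets of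
   norms, for which it is the usual supremum of a bounded nonempty set of
   reals, also when K = R[i]; see [scalars_supP] below. *)
Section operators.
Context {K : numFieldType}.

Definition opnorm (V W : normedModType K) (f : V -> W) : K :=
  supremum 0 [set `|f x| | x in [set x : V | `|x| <= 1]].

Definition compact_operator (V W : normedModType K) (T : {linear V -> W}) :
    Prop :=
  precompact (T @` [set x : V | `|x| <= 1]).

Definition dual (X : normedModType K) : set {linear X -> K^o} :=
  [set f : {linear X -> K^o} | continuous f].

Definition Pi_set (X : normedModType K) : set (X * {linear X -> K^o}) :=
  [set p | [/\ `|p.1| = 1, dual p.2, opnorm p.2 = 1 & p.2 p.1 = 1]].

Definition numerical_radius (X : normedModType K) (T : X -> X) : K :=
  supremum 0 [set `|p.2 (T p.1)| | p in @Pi_set X].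

End operators.

Definition BPBp_nu_compact (R : realType) (k : scalar_kind)
    (X : completeNormedModType (scalars R k)) : Prop :=
  forall eps : scalars R k, 0 < eps < 1 ->
  exists2 eta : scalars R k, 0 < eta < 1 &
  forall (T : {linear X -> X}) (x : X) (f : {linear X -> (scalars R k)^o}),
    compact_operator T -> Pi_set (x, f) ->
    numerical_radius T = 1 -> 1 - eta < `|f (T x)| ->
  exists (S : {linear X -> X}) (y : X) (g : {linear X -> (scalars R k)^o}),
    [/\ compact_operator S /\ Pi_set (y, g),
        numerical_radius S = 1 /\ `|g (S y)| = 1,
        opnorm (T \- S) < eps, `|x - y| < eps & opnorm (f \- g) < eps].

Section scalars_theory.
Context (R : realType).

Definition re_scalar (k : scalar_kind) : scalars R k -> R :=
  match k return scalars R k -> R with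
  | RealScalars => id | ComplexScalars => @complex.Re R end.

Definition of_real (k : scalar_kind) : R -> scalars R k :=
  match k return R -> scalars R k with
  | RealScalars => id | ComplexScalars => @real_complex R end.

Lemma le_of_real k (a b : R) : (of_real k a <= of_real k b) = (a <= b).
Proof. by case: k => //=; rewrite lecR. Qed.

Lemma lt_of_real k (a b : R) : (of_real k a < of_real k b) = (a < b).
Proof. by case: k => //=; rewrite ltcR. Qed.

Lemma of_real0 k : of_real k 0 = 0.
Proof. by case: k. Qed.

Lemma of_re_scalar k (z : scalars R k) : 0 <= z -> of_real k (re_scalar z) = z.
Proof. by case: k z => //= z z0; apply: RRe_real; exact: ger0_real. Qed.

Lemma re_scalar_dist k (x y : scalars R k) :
  of_real k `|re_scalar x - re_scalar y| <= `|x - y|.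
Proof. by case: k x y => //= x y; rewrite -raddfB; exact: normc_ge_Re. Qed.

Lemma re_scalar_continuous k : continuous (@re_scalar k).
Proof.
move=> x; apply/(cvgrPdist_lt (FF := nbhs_filter x)) => e e0.
have e0' : 0 < of_real k e by rewrite -(of_real0 k) lt_of_real.
apply/nbhs_ballP; exists (of_real k e) => // y; rewrite -ball_normE /= => xy.
by rewrite -(lt_of_real k); apply: le_lt_trans (re_scalar_dist _ _) xy.
Qed.

Lemma scalars_supP k (A : set (scalars R k)) (M : scalars R k) :
  A !=set0 -> (forall z, A z -> 0 <= z <= M) -> supremums A (supremum 0 A).
Proof.
move=> [z0 Az0] AM.
have M0 : 0 <= M by case/andP: (AM _ Az0) => /le_trans; apply.
have hsA : has_sup (@re_scalar k @` A).
  split; first by exists (re_scalar z0), z0.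
  exists (re_scalar M) => _ [z /AM/andP[z_ge0 zM] <-].
  by rewrite -(le_of_real k) !of_re_scalar.
have supA : supremums A (of_real k (sup (@re_scalar k @` A))).
  split=> [z Az|b Ab].
    have /andP[z_ge0 _] := AM _ Az.
    rewrite -[leLHS](of_re_scalar z_ge0) le_of_real.
    by apply: ub_le_sup; [case: hsA|exists z].
  have b0 : 0 <= b by apply: le_trans (Ab _ Az0); case/andP: (AM _ Az0).
  rewrite -[leRHS](of_re_scalar b0) le_of_real.
  apply: ge_sup; first by case: hsA.
  move=> _ [z Az <-]; have /andP[z_ge0 _] := AM _ Az.
  by rewrite -(le_of_real k) !of_re_scalar//; exact: Ab.
rewrite /supremum ifF; first by case: xgetP => // /(_ _ supA).
by apply/negbTE/set0P; exists z0.
Qed.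

Lemma normc_le_Re_Im (z : R[i]) :
  `|z| <= (`|complex.Re z| + `|complex.Im z|)%:C%C.
Proof.
rewrite normc_def lecR -[leRHS]ger0_norm ?addr_ge0// -sqrtr_sqr ler_wsqrtr//.
rewrite sqrrD !real_normK ?num_real// -addrA (addrC (_ *+ 2)) addrA lerDl.
by rewrite mulrn_wge0// mulr_ge0.
Qed.

Lemma scalars_complete k (F : set_system (scalars R k)) :
  ProperFilter F -> cauchy F -> cvg F.
Proof.
case: k F => [|] F FF Fc; first exact: R_complete.
have cauchy_image (g : R[i] -> R) :
    (forall x y, `|g x - g y|%:C%C <= `|x - y|) -> cvg (g @ F).
  move=> g_dist; apply: R_complete; apply/cauchyP => e e0.
  have e0' : 0 < e%:C%C by rewrite ltcR.
  move/cauchyP: Fc => /(_ _ e0')[x Fx]; exists (g x).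
  suff: F [set y | ball (g x) e (g y)] by [].
  apply: filterS Fx => y; rewrite -!ball_normE /= => xy.
  by rewrite -ltcR; apply: le_lt_trans xy.
have /cauchy_image/cvg_ex[/= a Fa] : forall x y : R[i],
    `|complex.Re x - complex.Re y|%:C%C <= `|x - y|.
  by move=> x y; rewrite -raddfB; exact: normc_ge_Re.
have /cauchy_image/cvg_ex[/= b Fb] : forall x y : R[i],
    `|complex.Im x - complex.Im y|%:C%C <= `|x - y|.
  move=> [x1 x2] [y1 y2] /=; rewrite normc_def lecR /= -sqrtr_sqr ler_wsqrtr//.
  by rewrite lerDr sqr_ge0.
apply: (@cvgP _ F (a +i* b)%C); apply/fcvgrPdist_lt => e e0.
have e2 : 0 < complex.Re e / 2.
  by rewrite divr_gt0//; move: e0; rewrite ltcE => /andP[].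
move/cvgrPdist_lt/(_ _ e2): Fa => Fa; move/cvgrPdist_lt/(_ _ e2): Fb => Fb.
have eE : (complex.Re e)%:C%C = e by apply: RRe_real; exact: gtr0_real.
near=> z.
have za : `|a - complex.Re z| < complex.Re e / 2 by near: z; exact: Fa.
have zb : `|b - complex.Im z| < complex.Re e / 2 by near: z; exact: Fb.
rewrite -eE [complex.Re e]splitr; apply: le_lt_trans (normc_le_Re_Im _) _.
by rewrite ltcR !raddfB ltrD.
Unshelve. all: by end_near. Qed.

End scalars_theory.

Section C0.
Context (R : realType) (k : scalar_kind) (L : topologicalType).
Local Notation K := (scalars R k).

Definition C0_pred : {pred L -> K} := mem [set f : L -> K |
  continuous f /\ forall eps : K, 0 < eps -> compact [set x | eps <= `|f x|]].

Record C0 := MkC0 { C0_fun :> L -> K; _ : C0_fun \in C0_pred }.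

HB.instance Definition _ := [isSub for C0_fun].
HB.instance Definition _ := [Choice of C0 by <:].

Lemma C0_continuous (f : C0) : continuous f.
Proof. by have := valP f; rewrite inE => -[]. Qed.

Lemma C0_vanish (f : C0) (eps : K) : 0 < eps -> compact [set x | eps <= `|f x|].
Proof. by have := valP f; rewrite inE => -[_]; exact. Qed.

Lemma closed_norm_ge (f : L -> K) (eps : K) : 0 < eps ->
  continuous f -> closed [set x | eps <= `|f x|].
Proof.
move=> e0 cf; rewrite [X in closed X](_ : _ = ~` (f @^-1` ball (0 : K) eps)).
  apply: open_closedC; apply: open_comp; last exact: ball_open.
  by move=> x _; exact: cf.
apply/seteqP; split=> x /=; rewrite -ball_normE /= sub0r normrN.
  by move=> /le_gtF ->.
by move=> /negP; rewrite -real_leNgt// ?gtr0_real// normr_real.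
Qed.

Lemma C0_submod_closed : submod_closed C0_pred.
Proof.
split=> [|a f g].
  rewrite inE; split; first by move=> x; exact: cst_continuous.
  move=> e e0; rewrite [X in compact X](_ : _ = set0); first exact: compact0.
  by rewrite -subset0 => x /=; rewrite normr0 lt_geF.
rewrite !inE => -[cf vf] [cg vg].
have cafg : continuous (a *: f + g).
  move=> x; apply: (@continuousD _ _ _ (a *: f) g x); last exact: cg.
  by apply: (@cvgMl_tmp _ _ _ (nbhs_filter x) _ a (f x)); exact: cf.
split=> // e e0.
have e2 : 0 < e / 2 by rewrite divr_gt0.
have a1 : 0 < `|a| + 1 by rewrite ltr_wpDl.
apply: subclosed_compact (closed_norm_ge e0 cafg) _ _.
  by apply: compactU (vf (e / 2 / (`|a| + 1)) _) (vg _ e2); rewrite divr_gt0.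
move=> x /= efg; apply: contrapT => /not_orP[].
move=> /negP; rewrite -real_ltNge ?normr_real ?gtr0_real ?divr_gt0// => fx.
move=> /negP; rewrite -real_ltNge ?normr_real ?gtr0_real// => gx.
have : `|a * f x + g x| < e.
  apply: le_lt_trans (ler_normD _ _) _; rewrite [ltRHS]splitr.
  rewrite ler_ltD// normrM; move: fx; rewrite ltr_pdivlMr// mulrC => /ltW.
  by apply: le_trans; rewrite ler_wpM2r// lerDl.
by move/lt_geF; rewrite efg.
Qed.

HB.instance Definition _ := GRing.isSubmodClosed.Build _ _ C0_pred
  C0_submod_closed.
HB.instance Definition _ := [SubChoice_isSubLmodule of C0 by <:].

Definition C0_norm (f : C0) : K := supremum 0 (range (fun x => `|f x|)).

Lemma C0_bounded (f : C0) : exists2 M : K, 0 <= M & forall x, `|f x| <= M.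
Proof.
pose h x := re_scalar `|f x|.
have ch : continuous h.
  move=> x; apply: (@continuous_comp _ _ _ (fun x => `|f x|) (@re_scalar R k)).
    apply: (@continuous_comp _ _ _ f (fun z : K => `|z|)).
      exact: C0_continuous.
    exact: norm_continuous.
  exact: re_scalar_continuous.
have cK : compact (h @` [set x | 1 <= `|f x|]).
  apply: continuous_compact; last exact: C0_vanish.
  exact: continuous_subspaceT.
have /filter_ex[M hM] : \forall M \near +oo,
  forall z, (h @` [set x | 1 <= `|f x|]) z -> `|z| <= M := compact_bounded cK.
have M0 : 0 <= of_real k `|M| by rewrite -(of_real0 R k) le_of_real.
exists (1 + of_real k `|M|) => [|x]; first by rewrite addr_ge0.
have [fx1|] := boolP (1 <= `|f x|); last first.
  by rewrite -real_ltNge// => /ltW /le_trans; apply; rewrite lerDl.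
have : h x <= `|M|.
  apply: le_trans (ler_norm _) (le_trans _ (ler_norm _)).
  by apply: hM; exists x.
rewrite -(le_of_real k) of_re_scalar// => /le_trans; apply.
by rewrite lerDr.
Qed.

Lemma C0_norm_ub (f : C0) (x : L) : `|f x| <= C0_norm f.
Proof.
have [M M0 fM] := C0_bounded f.
have [|_ [y _ <-]|+ _] := @scalars_supP _ _ (range (fun x => `|f x|)) M.
- by exists `|f x|, x.
- by rewrite normr_ge0 fM.
- by apply; exists x.
Qed.

Lemma C0_norm_le (f : C0) (M : K) :
  0 <= M -> (forall x, `|f x| <= M) -> C0_norm f <= M.
Proof.
move=> M0 fM; rewrite /C0_norm.
have [->|/set0P ne] := eqVneq (range (fun x => `|f x|)) set0.
  by rewrite supremum0.
have [//|_ [y _ <-]|_] := @scalars_supP _ _ (range (fun x => `|f x|)) M.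
  by rewrite normr_ge0 fM.
by apply=> _ [x _ <-].
Qed.

Lemma C0_norm_ge0 (f : C0) : 0 <= C0_norm f.
Proof.
have [[x _]|L0] := pselect ([set: L] !=set0).
  exact: le_trans (C0_norm_ub f x).
rewrite /C0_norm (_ : [set `|f x| | x in [set: L]] = set0) ?supremum0//.
by rewrite -subset0 => z [x _ _]; apply: L0; exists x.
Qed.

Lemma C0_normD (f g : C0) : C0_norm (f + g) <= C0_norm f + C0_norm g.
Proof.
apply: C0_norm_le => [|x]; first by rewrite addr_ge0// C0_norm_ge0.
by apply: le_trans (ler_normD _ _) _; rewrite lerD// C0_norm_ub.
Qed.

Lemma C0_normZ_le (a : K) (f : C0) : C0_norm (a *: f) <= `|a| * C0_norm f.
Proof.
apply: C0_norm_le => [|x]; first by rewrite mulr_ge0// C0_norm_ge0.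
by rewrite normrM ler_wpM2l// C0_norm_ub.
Qed.

Lemma C0_normZ (a : K) (f : C0) : C0_norm (a *: f) = `|a| * C0_norm f.
Proof.
apply/eqP; rewrite eq_le C0_normZ_le /=; have [->|a0] := eqVneq a 0.
  by rewrite normr0 mul0r C0_norm_ge0.
rewrite -ler_pdivlMl ?normr_gt0// -normfV -{1}[f](scalerK a0).
exact: C0_normZ_le.
Qed.

Lemma C0_norm_eq0 (f : C0) : C0_norm f = 0 -> f = 0.
Proof.
move=> f0; apply/val_inj/funext => x; apply/eqP.
by rewrite -normr_le0 -f0 C0_norm_ub.
Qed.

HB.instance Definition _ := Lmodule_isNormed.Build K C0
  C0_normD C0_normZ C0_norm_eq0.

Lemma C0_dist_ub (f g : C0) (x : L) : `|f x - g x| <= `|f - g|.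
Proof. exact: C0_norm_ub (f - g) x. Qed.

Lemma C0_complete (F : set_system C0) : ProperFilter F -> cauchy F -> cvg F.
Proof.
move=> FF /cauchyP Fc.
have cauchy_at (x : L) : cvg ((fun f : C0 => f x) @ F).
  apply: scalars_complete; apply/cauchyP => e e0.
  have [f Ff] := Fc _ e0; exists (f x).
  suff: F [set g : C0 | ball (f x) e (g x)] by [].
  apply: filterS Ff => g; rewrite -!ball_normE /= => fg.
  exact: le_lt_trans (C0_dist_ub _ _ _) fg.
pose g x : K := lim ((fun f : C0 => f x) @ F).
have gE (e : K) : 0 < e ->
    exists f : C0, F (ball f e) /\ forall x, `|g x - f x| <= e.
  move=> e0; have [f Ff] := Fc _ e0; exists f; split=> // x.
  have gx : (fun f : C0 => f x) @ F --> g x by exact: cauchy_at.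
  apply/ler_addgt0Pr => d d0; move/cvgrPdist_lt/(_ _ d0): gx => gx.
  have [h [/= fh gh]] := filter_ex (filterI Ff gx).
  rewrite (le_trans (ler_distD (h x) _ _))// addrC lerD ?(ltW gh)// distrC.
  apply: le_trans (C0_dist_ub _ _ _) _.
  by move: fh; rewrite -ball_normE => /ltW.
have cg : continuous g.
  move=> x; apply/(cvgrPdist_lt (FF := nbhs_filter x)) => e e0.
  have e3 : 0 < e / 3 by rewrite divr_gt0.
  have [f [_ gf]] := gE _ e3.
  have /(cvgrPdist_lt (FF := nbhs_filter x))/(_ _ e3) := @C0_continuous f x.
  apply: filterS => y fxy.
  rewrite (_ : e = e / 3 + e / 3 + e / 3); last first.
    by rewrite -!mulrDl -mulr2n -mulrSr -(mulr_natr e) mulfK.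
  apply: le_lt_trans (ler_distD (f y) _ _) _.
  rewrite ltr_leD//; last by rewrite distrC.
  apply: le_lt_trans (ler_distD (f x) _ _) _.
  by rewrite ler_ltD.
have vg : g \in C0_pred.
  rewrite inE; split=> // e e0.
  have e2 : 0 < e / 2 by rewrite divr_gt0.
  have [f [_ gf]] := gE _ e2.
  apply: (subclosed_compact (closed_norm_ge e0 cg) (@C0_vanish f _ e2)).
  move=> x /= egx.
  rewrite -(lerD2l (e / 2)) -splitr (le_trans egx)//.
  by rewrite -[g x](subrK (f x)) (le_trans (ler_normD _ _))// lerD.
apply: (@cvgP _ F (MkC0 vg : C0)); apply/fcvgrPdist_lt => e e0.
have e3 : 0 < e / 3 by rewrite divr_gt0.
have [f [Ff gf]] := gE _ e3.
apply: filterS Ff => h; rewrite -ball_normE /= => fh.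
rewrite (_ : e = e / 3 + e / 3 + e / 3); last first.
    by rewrite -!mulrDl -mulr2n -mulrSr -(mulr_natr e) mulfK.
apply: le_lt_trans (ler_distD f _ _) _; rewrite ler_ltD//.
apply: (@le_trans _ _ (e / 3)); last by rewrite lerDl ltW.
by apply: C0_norm_le => [|x]; [exact: ltW|exact: gf].
Qed.

HB.instance Definition _ := Uniform_isComplete.Build C0 C0_complete.

End C0.

(* Main.v *)
(* Idea.  C_0(L) has numerical index one, so |T| = nu(T) = 1.  Normalise a
   scalar c so that h = c T x satisfies Re l(h) > 1 - eta, where l is the given
   functional.  Then l is almost
   carried by the set where Re (h conj(x)) is close to 1: cutting l off to this
   set and normalising gives g close to l.  Let y be x pushed radially onto the
   unit circle wherever |x| is close to 1; g still attains its norm at y.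
   Since T is compact, T f is uniformly close to sum_j p_j (T f)(t_j) for a
   finite partition (p_j) subordinate to a fine cover of L.  For the t_j in the
   good set, the functional c conj(y(t_j)) (T .)(t_j) almost attains its norm at
   x; by Hahn-Banach it is close to a functional tau_j of norm one with
   tau_j y = 1.  Replacing (T f)(t_j) by conj(c) y tau_j f at these indices gives
   a finite rank contraction S with S y = conj(c) y wherever g lives, so that
   g (S y) = conj(c). *)
From HB Require Import structures.
Require Import Defs.
From mathcomp Require Import all_boot all_order all_algebra.
From mathcomp Require Import all_classical all_reals all_analysis.
From mathcomp Require Import complex ring lra.

Set Implicit Arguments.
Unset Strict Implicit.
Unset Printing Implicit Defensive.

Import Order.TTheory GRing.Theory Num.Theory.
Import numFieldNormedType.Exports.

Local Open Scope classical_set_scope.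
Local Open Scope ring_scope.

(** Measures representing functionals never appear. If [l] has norm one and l x = 1 with |x| = 1,
    then for 0 <= u <= 1 the functional f |-> l (u f) has norm l (u x). So the norms of l (u f) and
    l ((1 - u) f) add up to 1, and cutting off and normalising costs at most twice the mass
    discarded. Two exact equalities shape the rest. g y = 1 holds because x is the midpoint of y and
    2 x - y, both in the unit ball; this is what the radial push provides. |g (S y)| = 1 needs S y
    to be a multiple of y where g lives, so the modified rows are multiplied by the function y, not
    by the constants y (t_j). Constants for accuracy e: b = e / 8 bounds both |x - y| and the change
    of each row. A norm one functional with real part at least 1 - b ^ 2 / 4 at x can be moved by b;
    as 3 dl is lost (2 dl in the transition of the cutoff, dl in the oscillation over the
    partition), dl = b ^ 2 / 12. With eta = dl e / 16 the functional moves by 4 eta / dl = e / 4. *)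

(** * Scalars: real parts, moduli and conjugates, for both fields at once *)

Section scalar_fields.
Context (R : realType) (k : scalar_kind).
Local Notation K := (scalars R k).
Local Notation re := (@re_scalar R k).
Local Notation rc := (@of_real R k).
Implicit Types (z w : K) (r s : R).

(** The norm of [K] takes its values in [K]; the real-valued form lets every estimate be made in
    [R], for both kinds of scalars. *)
Definition modulus (z : K) : R := re `|z|.

Definition conj_scalar : K -> K :=
  match k return scalars R k -> scalars R k with
  | RealScalars => id | ComplexScalars => @conjc R end.

Lemma of_real_modulus z : rc (modulus z) = `|z|.
Proof. by rewrite of_re_scalar. Qed.

Lemma re_of_real r : re (rc r) = r.
Proof. by rewrite /re_scalar /of_real; case: k. Qed.

Lemma re_scalarD z w : re (z + w) = re z + re w.
Proof. by move: z w; rewrite /re_scalar; case: k => //= -[? ?] [? ?]. Qed.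

Lemma re_scalarN z : re (- z) = - re z.
Proof. by move: z; rewrite /re_scalar; case: k => //= -[? ?]. Qed.

Lemma re_scalarB z w : re (z - w) = re z - re w.
Proof. by rewrite re_scalarD re_scalarN. Qed.

Lemma re_scalarM r z : re (rc r * z) = r * re z.
Proof.
by move: z; rewrite /re_scalar /of_real; case: k => //= -[? ?] /=; rewrite mul0r subr0.
Qed.

Lemma of_realD r s : rc (r + s) = rc r + rc s.
Proof. by rewrite /of_real; case: k => //=; rewrite rmorphD. Qed.

Lemma of_realN r : rc (- r) = - rc r.
Proof. by rewrite /of_real; case: k => //=; rewrite rmorphN. Qed.

Lemma of_realB r s : rc (r - s) = rc r - rc s.
Proof. by rewrite of_realD of_realN. Qed.

Lemma of_realM r s : rc (r * s) = rc r * rc s.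
Proof. by rewrite /of_real; case: k => //=; rewrite rmorphM. Qed.

Lemma of_real1 : rc 1 = 1.
Proof. by rewrite /of_real; case: k. Qed.

Lemma modulus_le z r : (modulus z <= r) = (`|z| <= rc r).
Proof. by rewrite -of_real_modulus le_of_real. Qed.

Lemma modulus_ge0 z : 0 <= modulus z.
Proof. by rewrite -(le_of_real k) of_real_modulus of_real0. Qed.

Lemma modulusD z w : modulus (z + w) <= modulus z + modulus w.
Proof. by rewrite modulus_le of_realD !of_real_modulus ler_normD. Qed.

Lemma modulusN z : modulus (- z) = modulus z.
Proof. by rewrite /modulus normrN. Qed.

Lemma modulusBC z w : modulus (z - w) = modulus (w - z).
Proof. by rewrite /modulus distrC. Qed.

Lemma modulusM z w : modulus (z * w) = modulus z * modulus w.
Proof.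
by rewrite /modulus normrM -{1}of_real_modulus re_scalarM.
Qed.

Lemma modulus_of_real r : modulus (rc r) = `|r|.
Proof.
have -> : `|r| = re (rc `|r|) by rewrite re_of_real.
congr re; rewrite /of_real; case: k => //=.
by rewrite normc_def /= expr0n /= addr0 sqrtr_sqr.
Qed.

Lemma modulus0 : modulus 0 = 0.
Proof. by rewrite -(of_real0 R k) modulus_of_real normr0. Qed.

Lemma modulus1 : modulus 1 = 1.
Proof. by rewrite -of_real1 modulus_of_real normr1. Qed.

Lemma modulus_eq0 z : (modulus z == 0) = (z == 0).
Proof.
by rewrite -[RHS]normr_eq0 -of_real_modulus -(inj_eq (can_inj re_of_real)) of_real0.
Qed.

Lemma norm_re_scalar_le z : `|re z| <= modulus z.
Proof.
rewrite -(le_of_real k) of_real_modulus.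
by have := re_scalar_dist z 0; rewrite subr0 -(of_real0 R k) re_of_real subr0.
Qed.

Lemma re_scalar_le z : re z <= modulus z.
Proof. exact: le_trans (ler_norm _) (norm_re_scalar_le z). Qed.

Lemma modulus_conj z : modulus (conj_scalar z) = modulus z.
Proof.
rewrite /modulus; congr re; move: z; rewrite /conj_scalar; case: k => //= z.
by rewrite [LHS]normcJ.
Qed.

Lemma mul_conj_scalar z : z * conj_scalar z = rc (modulus z ^+ 2).
Proof.
rewrite expr2 of_realM !of_real_modulus -expr2; move: z.
rewrite /conj_scalar; case: k => //= z; first by rewrite -expr2 real_normK ?num_real.
by rewrite sqr_normc.
Qed.

Lemma conj_scalarM z w : conj_scalar (z * w) = conj_scalar z * conj_scalar w.
Proof.
by move: z w; rewrite /conj_scalar; case: k => //= z w; rewrite rmorphM.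
Qed.

Lemma conj_of_real r : conj_scalar (rc r) = rc r.
Proof. by rewrite /conj_scalar /of_real; case: k => //=; rewrite oppr0. Qed.

Lemma conj_scalarD z w : conj_scalar (z + w) = conj_scalar z + conj_scalar w.
Proof.
by move: z w; rewrite /conj_scalar; case: k => //= z w; rewrite rmorphD.
Qed.

Lemma conj_scalarB z w : conj_scalar (z - w) = conj_scalar z - conj_scalar w.
Proof.
by move: z w; rewrite /conj_scalar; case: k => //= z w; rewrite rmorphB.
Qed.

Lemma re_conj z : re (conj_scalar z) = re z.
Proof. by move: z; rewrite /re_scalar /conj_scalar; case: k => //= -[]. Qed.

Lemma conj_scalarK z : conj_scalar (conj_scalar z) = z.
Proof. by move: z; rewrite /conj_scalar; case: k => //= z; rewrite conjcK. Qed.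

Lemma re_mul_conjC z w : re (z * conj_scalar w) = re (w * conj_scalar z).
Proof. by rewrite -re_conj conj_scalarM conj_scalarK mulrC. Qed.

Lemma modulus_sqr z : modulus z ^+ 2 = re (z * conj_scalar z).
Proof. by rewrite mul_conj_scalar re_of_real. Qed.

Lemma modulus_sqrD z w s : modulus (z + rc s * w) ^+ 2 =
  modulus z ^+ 2 + 2 * s * re (w * conj_scalar z) + s ^+ 2 * modulus w ^+ 2.
Proof.
rewrite !modulus_sqr conj_scalarD conj_scalarM conj_of_real mulrDl !mulrDr.
rewrite !re_scalarD -!mulrA !re_scalarM mulrCA !re_scalarM (re_mul_conjC z w).
rewrite [w * (rc s * _)]mulrCA re_scalarM; ring.
Qed.

Lemma exists_rotation z : exists2 u, modulus u = 1 & u * z = rc (modulus z).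
Proof.
have [->|z0] := eqVneq z 0; first by exists 1; rewrite ?modulus1// mulr0 modulus0 of_real0.
have m0 : modulus z != 0 by rewrite modulus_eq0.
exists (rc (modulus z)^-1 * conj_scalar z).
  rewrite modulusM modulus_of_real modulus_conj ger0_norm ?mulVf//.
  by rewrite invr_ge0 modulus_ge0.
by rewrite -mulrA [_ * z]mulrC mul_conj_scalar -of_realM expr2 mulKf.
Qed.

(** Expanding, |z - r|^2 = |z|^2 - 2 r re z + r^2, which is at most r^2 - 2 r^2 + r^2 = 0. *)
Lemma eq_of_real z r : modulus z <= r -> re z = r -> z = rc r.
Proof.
move=> zr rz; apply/eqP; rewrite -subr_eq0 -modulus_eq0 -sqrf_eq0.
have r0 : 0 <= r by apply: le_trans zr; exact: modulus_ge0.
rewrite -[_ - _](_ : z + rc (- 1) * rc r = _); last first.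
  by rewrite of_realN of_real1 mulN1r.
rewrite modulus_sqrD re_scalarM re_conj rz modulus_of_real ger0_norm //.
have : modulus z ^+ 2 <= r ^+ 2 by rewrite ler_sqr ?nnegrE ?modulus_ge0.
have := sqr_ge0 (modulus (z + rc (- 1) * rc r)).
rewrite modulus_sqrD re_scalarM re_conj rz modulus_of_real ger0_norm //.
by move=> *; apply/eqP; lra.
Qed.

(** Writing z = |z| w with |w| = 1, the ends w and -w of the diameter through z carry the weights (1
    + |z|) / 2 and (1 - |z|) / 2. *)
Lemma modulus_conv_unit z : modulus z <= 1 -> exists r z1 z2,
  [/\ 0 <= r <= 1, modulus z1 = 1, modulus z2 = 1 &
      z = rc r * z1 + rc (1 - r) * z2].
Proof.
move=> z1; have [u u1 uz] := exists_rotation z.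
have uu : conj_scalar u * u = 1 by rewrite mulrC mul_conj_scalar u1 expr1n of_real1.
exists ((1 + modulus z) / 2), (conj_scalar u), (- conj_scalar u).
rewrite modulusN modulus_conj; split=> //.
  by have := modulus_ge0 z; lra.
rewrite mulrN -mulrBl -of_realB (_ : _ - _ = modulus z); last by field.
by rewrite -uz mulrAC [u * _]mulrC uu mul1r.
Qed.
End scalar_fields.

(** * The Hahn-Banach theorem over both fields *)

Section hahn_banach.
Context (R : realType) (k : scalar_kind).
Local Notation K := (scalars R k).
Local Notation re := (@re_scalar R k).
Local Notation rc := (@of_real R k).

(** Only an inequality is asked for positive scalars, since that is easily checked for infima;
    [sublinearZ] recovers equality by using 1 / r as well. *)
Definition sublinear (V : lmodType K) (p : V -> R) : Prop :=
  (forall f g, p (f + g) <= p f + p g) /\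
  (forall r f, 0 < r -> p (rc r *: f) <= r * p f).

Lemma le_infD (A B : set R) (m : R) : A !=set0 -> B !=set0 ->
  (forall a b, A a -> B b -> m <= a + b) -> m <= inf A + inf B.
Proof.
move=> A0 B0 mAB; rewrite -lerBlDr; apply: lb_le_inf => // a Aa.
by rewrite lerBlDr addrC -lerBlDr; apply: lb_le_inf => // b Bb;
  rewrite lerBlDr addrC mAB.
Qed.

Lemma inf_le_pmul (A : set R) (m r : R) : 0 < r -> A !=set0 ->
  (forall a, A a -> m <= r * a) -> m <= r * inf A.
Proof.
move=> r0 A0 mA; rewrite mulrC -ler_pdivrMr//; apply: lb_le_inf => // a Aa.
by rewrite ler_pdivrMr// mulrC mA.
Qed.

Section sublinear_theory.
Variables (V : lmodType K) (p : V -> R).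
Hypothesis sp : sublinear p.

Lemma sublinear0 : p 0 = 0.
Proof.
have [pD pZ] := sp; apply/eqP; rewrite eq_le.
have := pZ (1 / 2) 0; have := pD 0 0; rewrite addr0 scaler0; lra.
Qed.

Lemma sublinearN_ge f : - p (- f) <= p f.
Proof. by have [+ _] := sp => /(_ f (- f)); rewrite subrr sublinear0; lra. Qed.

Lemma sublinearZ r f : 0 <= r -> p (rc r *: f) = r * p f.
Proof.
rewrite le_eqVlt => /predU1P[<-|r0].
  by rewrite of_real0 scale0r mul0r sublinear0.
have [_ pZ] := sp; apply/eqP; rewrite eq_le pZ//=.
have ri : 0 < r^-1 by rewrite invr_gt0.
have := pZ r^-1 (rc r *: f) ri.
rewrite scalerA -of_realM mulVf ?gt_eqF// of_real1 scale1r mulrC.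
by rewrite ler_pdivlMr// mulrC.
Qed.

End sublinear_theory.

(** Zorn's lemma: along a chain the pointwise infimum is finite because p f >= - p (- f) >= - q (-
    f). *)
Lemma minimal_sublinear (V : lmodType K) (q : V -> R) : sublinear q ->
  exists p, [/\ sublinear p, forall f, p f <= q f &
    forall p', sublinear p' -> (forall f, p' f <= p f) -> p' = p].
Proof.
move=> sq; pose T := {p : V -> R | sublinear p /\ forall f, p f <= q f}.
(* The order is reversed, so that a maximal element is a minimal functional. *)
pose le (s t : T) := `[< forall f, sval t f <= sval s f >].
have [] := @Zorn T le.
- by move=> t; apply/asboolP.
- by move=> r s t /asboolP rs /asboolP st; apply/asboolP => f; exact: le_trans (rs f).
- move=> [s ?] [t ?] /asboolP /= st /asboolP /= ts; apply/eq_exist.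
  by apply/funext => f; apply/eqP; rewrite eq_le st ts.
- move=> A Atot; have [[p0 Ap0]|A0] := pselect (A !=set0); last first.
    by exists (exist _ q (conj sq (fun=> lexx _))) => s As; case: A0; exists s.
  pose E f := [set sval s f | s in A].
  have En f : E f !=set0 by exists (sval p0 f), p0.
  have Elb f : has_lbound (E f).
    exists (- q (- f)) => _ [[p [sp pq]] _ <-] /=.
    by apply: le_trans (sublinearN_ge sp f); rewrite lerN2 pq.
  pose m f := inf (E f).
  have mE s f : A s -> m f <= sval s f.
    by move=> As; apply: ge_inf; [exact: Elb|exists s].
  have sm : sublinear m.
    split=> [f g|r f r0].
      apply: le_infD => // _ _ [s As <-] [t At <-].
      (* The smaller of the two functionals, evaluated at f + g, is below s f + t g. *)
      have [/asboolP st|/asboolP ts] := Atot _ _ As At.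
        have [[pD _] _] := svalP t.
        apply: le_trans (mE _ _ At) (le_trans (pD _ _) _).
        by rewrite lerD2r.
      have [[pD _] _] := svalP s.
      apply: le_trans (mE _ _ As) (le_trans (pD _ _) _).
      by rewrite lerD2l.
    apply: inf_le_pmul => // _ [s As <-]; have [[_ pZ] _] := svalP s.
    exact: le_trans (mE _ _ As) (pZ _ _ _).
  have mq f : m f <= q f.
    by apply: le_trans (mE _ _ Ap0) _; have [_] := svalP p0.
  exists (exist _ m (conj sm mq)) => s As; apply/asboolP => f /=.
  exact: mE.
move=> [p [sp pq]] pmin; exists p; split=> // p' sp' p'p.
have p'q f : p' f <= q f by exact: le_trans (pq f).
by have := pmin (exist _ p' (conj sp' p'q)) (asboolT p'p) => /(congr1 sval).
Qed.

(** A minimal sublinear p is additive: the auxiliary infimum below is at most p (take t = 0), hence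
    equal to p, and t = 1 then gives p f <= p (f + g) - p g. *)
Lemma real_hahn_banach (V : lmodType K) (q : V -> R) : sublinear q ->
  exists u : V -> R, [/\ {morph u : f g / f + g},
    forall r f, u (rc r *: f) = r * u f & forall f, u f <= q f].
Proof.
move=> /minimal_sublinear[p [sp pq pmin]].
have [pD pZ] := sp.
have pDE f g : p (f + g) = p f + p g.
  apply/eqP; rewrite eq_le pD /=.
  (* the infimum over t >= 0 of p (f + t g) - t p g is again sublinear *)
  pose E f := [set p (f + rc t *: g) - t * p g | t in [set t | 0 <= t]].
  have Ep h : E h (p h) by exists 0; rewrite //= of_real0 scale0r addr0 mul0r subr0.
  have En h : E h !=set0 by exists (p h).
  have Elb h : has_lbound (E h).
    exists (- p (- h)) => _ [t /= t0 <-].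
    rewrite -(sublinearZ sp)// lerBrDr addrC -lerBrDr opprK.
    by rewrite (le_trans _ (pD _ _))// addrAC subrr add0r.
  have sm : sublinear (fun h => inf (E h)).
    split=> [f1 f2|r h r0].
      apply: le_infD => // _ _ [s /= s0 <-] [t /= t0 <-].
      apply: (@le_trans _ _ (p (f1 + f2 + rc (s + t) *: g) - (s + t) * p g)).
        by apply: ge_inf => //; exists (s + t) => //=; exact: addr_ge0.
      have := pD (f1 + rc s *: g) (f2 + rc t *: g).
      by rewrite of_realD scalerDl addrACA; lra.
    apply: inf_le_pmul => // _ [t /= t0 <-].
    apply: (@le_trans _ _ (p (rc r *: h + rc (r * t) *: g) - (r * t) * p g)).
      by apply: ge_inf => //; exists (r * t) => //=; exact: mulr_ge0 (ltW _) _.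
    by rewrite of_realM -scalerA -scalerDr mulrBr mulrA lerD2r pZ.
  have := pmin _ sm; move=> /(_ (fun h => ge_inf (Elb h) (Ep h))).
  move=> /(congr1 (fun h => h f)) <-; rewrite -lerBrDr.
  apply: ge_inf => //; exists 1 => //=.
  by rewrite of_real1 scale1r mul1r.
have p0 := sublinear0 sp.
have pN f : p (- f) = - p f.
  by apply/eqP; rewrite -addr_eq0 -pDE addNr p0.
exists p; split=> // r f; have [r0|r0] := leP 0 r; first exact: sublinearZ.
by rewrite -[r]opprK of_realN scaleNr pN sublinearZ ?mulNr// oppr_ge0 ltW.
Qed.

Lemma scalar_extension (V : lmodType K) (u : V -> R) :
  {morph u : f g / f + g} -> (forall r f, u (rc r *: f) = r * u f) ->
  exists t : {linear V -> K^o}, forall f, re (t f) = u f.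
Proof.
rewrite /re_scalar /of_real; move: V u; case: k => /= V u uD uZ.
  have ul : linear (u : V -> R^o) by move=> a f g; rewrite uD uZ.
  by exists (HB.pack_for {linear V -> R^o} (u : V -> R^o) (GRing.isLinear.Build _ _ _ _ _ ul)).
(* The imaginary part is forced by linearity: Im (t f) = - Re (i t f) = - u (i f). *)
pose t (f : V) : (R[i])^o := (u f +i* - u ('i%C *: f))%C.
have uN f : u (- f) = - u f.
  by have := uZ (-1) f; rewrite rmorphN rmorph1 scaleN1r mulN1r.
have tl : linear t.
  move=> [a b] f g; rewrite /t.
  have e h : (a +i* b)%C *: h = a%:C%C *: h + b%:C%C *: ('i%C *: h) :> V.
    by rewrite scalerA -scalerDl; congr (_ *: _); simpc.
  have ii : 'i%C *: ('i%C *: f) = - f by rewrite scalerA -expr2 sqr_i scaleN1r.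
  rewrite scalerDr scalerA (mulrC 'i%C) -scalerA !e ii.
  rewrite !uD !uZ uN /GRing.scale /=; simpc.
  by congr (_ +i* _)%C; ring.
by exists (HB.pack_for {linear V -> (R[i])^o} t (GRing.isLinear.Build _ _ _ _ _ tl)).
Qed.

(** Norm bounds, prescribed values and closeness to a given functional are all to be encoded in the
    choice of [q]. *)
Theorem hahn_banach (V : lmodType K) (q : V -> R) : sublinear q ->
  exists t : {linear V -> K^o}, forall f, re (t f) <= q f.
Proof.
move=> /real_hahn_banach[u [uD uZ uq]].
have [t tu] := scalar_extension uD uZ.
by exists t => f; rewrite tu.
Qed.

End hahn_banach.

(** * Continuity of the scalar operations *)

Section scalar_continuity.
Context (R : realType) (k : scalar_kind).
Local Notation K := (scalars R k).

Lemma modulus_continuous : continuous (@modulus R k).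
Proof.
move=> x; apply: (@continuous_comp _ _ _ (fun z : K => `|z|) (@re_scalar R k)).
  exact: norm_continuous.
exact: re_scalar_continuous.
Qed.

Lemma continuous_of_dist (T : pseudoMetricNormedZmodType R)
  (V : pseudoMetricNormedZmodType K) (f : T -> V) :
  (forall x y, `|f x - f y| <= of_real k `|x - y|) -> continuous f.
Proof.
move=> fl x; apply/(cvgrPdist_lt (FF := nbhs_filter x)) => e e0.
have e0' : 0 < re_scalar e.
  by rewrite -(lt_of_real k) of_real0 of_re_scalar // ltW.
apply/nbhs_ballP; exists (re_scalar e) => // y; rewrite -ball_normE /= => xy.
apply: le_lt_trans (fl _ _) _.
by rewrite -[ltRHS]of_re_scalar ?ltW// lt_of_real.
Qed.

Lemma of_real_continuous : continuous (@of_real R k).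
Proof.
apply: continuous_of_dist => x y.
by rewrite -of_realB -of_real_modulus modulus_of_real.
Qed.

Lemma conj_scalar_continuous : continuous (@conj_scalar R k).
Proof.
move=> x; apply/(cvgrPdist_lt (FF := nbhs_filter x)) => e e0.
apply/nbhs_ballP; exists e => // y; rewrite -ball_normE /=.
by rewrite -[ltLHS]of_real_modulus -modulus_conj conj_scalarB of_real_modulus.
Qed.

Lemma continuous_maxr (T : topologicalType) (f g : T -> R) :
  continuous f -> continuous g -> continuous (fun t => Num.max (f t) (g t)).
Proof.
by move=> cf cg x; apply: (@continuous_max R T f g x); [exact: cf|exact: cg].
Qed.

Lemma continuous_minr (T : topologicalType) (f g : T -> R) :
  continuous f -> continuous g -> continuous (fun t => Num.min (f t) (g t)).
Proof.
by move=> cf cg x; apply: (@continuous_min R T f g x); [exact: cf|exact: cg].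
Qed.

End scalar_continuity.

(** * Pointwise calculus and the real-valued norm of C_0(L) *)

Section C0_norms.
Context (R : realType) (k : scalar_kind) (L : topologicalType).
Local Notation K := (scalars R k).
Local Notation X := (C0 R k L).
Local Notation rc := (@of_real R k).
Implicit Types (f g : X) (t : L).

Lemma C0DE f g t : (f + g) t = f t + g t. Proof. by []. Qed.
Lemma C0NE f t : (- f) t = - f t. Proof. by []. Qed.
Lemma C0BE f g t : (f - g) t = f t - g t. Proof. by []. Qed.
Lemma C0ZE (a : K) f t : (a *: f) t = a * f t. Proof. by []. Qed.
Lemma C00E t : (0 : X) t = 0. Proof. by []. Qed.

Lemma C0_sumE (I : Type) (s : seq I) (F : I -> X) t :
  (\sum_(i <- s) F i) t = \sum_(i <- s) F i t.
Proof. by elim/big_rec2: _ => // i y x _ <-. Qed.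

Definition supnorm f : R := re_scalar `|f|.

Lemma of_real_supnorm f : rc (supnorm f) = `|f|.
Proof. by rewrite of_re_scalar. Qed.

Lemma supnorm_ge0 f : 0 <= supnorm f.
Proof. by rewrite -(le_of_real k) of_real_supnorm of_real0. Qed.

Lemma le_supnorm f t : modulus (f t) <= supnorm f.
Proof. by rewrite modulus_le of_real_supnorm; exact: C0_norm_ub. Qed.

Lemma supnorm_le f (r : R) : 0 <= r -> (forall t, modulus (f t) <= r) ->
  supnorm f <= r.
Proof.
move=> r0 fr; rewrite -(le_of_real k) of_real_supnorm; apply: C0_norm_le.
  by rewrite -(of_real0 R k) le_of_real.
by move=> t; rewrite -modulus_le.
Qed.

Lemma supnormD f g : supnorm (f + g) <= supnorm f + supnorm g.
Proof. by rewrite -(le_of_real k) of_realD !of_real_supnorm ler_normD. Qed.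

Lemma supnormZ (a : K) f : supnorm (a *: f) = modulus a * supnorm f.
Proof.
by rewrite /supnorm normrZ -of_real_modulus re_scalarM.
Qed.

Lemma supnormN f : supnorm (- f) = supnorm f.
Proof. by rewrite /supnorm normrN. Qed.

Lemma supnorm0 : supnorm 0 = 0.
Proof. by rewrite -(scale0r 0) supnormZ modulus0 mul0r. Qed.

Lemma supnorm_eq0 f : supnorm f = 0 -> f = 0.
Proof. by move=> f0; apply/eqP; rewrite -normr_eq0 -of_real_supnorm f0 of_real0. Qed.

(** Falls back to 0 when [g] is not in C_0(L); hence evaluating it always calls for a domination
    argument. *)
Definition toC0 (g : L -> K) : X := insubd 0 g.

(** The set where |g| >= e is closed and contained in the compact set where |f| >= e / max(M, 1);
    the maximum keeps the divisor positive. *)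
Lemma toC0E (g : L -> K) (f : X) (M : R) : continuous g ->
  (forall t, modulus (g t) <= M * modulus (f t)) -> forall t, toC0 g t = g t.
Proof.
move=> cg gf t; rewrite /toC0 insubdK// inE; split=> // e e0.
have M0 : 0 < Num.max M 1 by rewrite lt_max ltr01 orbT.
have Me : 0 < e / rc (Num.max M 1).
  by rewrite divr_gt0// -(of_real0 R k) lt_of_real.
apply: subclosed_compact (closed_norm_ge e0 cg) (@C0_vanish _ _ _ f _ Me) _.
move=> x /= ex.
rewrite ler_pdivrMr -?(of_real0 R k) ?lt_of_real//.
apply: le_trans ex _; rewrite -!of_real_modulus -of_realM le_of_real.
apply: le_trans (gf _) _; rewrite mulrC ler_wpM2l ?modulus_ge0//.
by rewrite le_max lexx.
Qed.

Definition funC0 (a : L -> K) (f : X) : X := toC0 (fun t => a t * f t).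

Lemma funC0E (a : L -> K) (M : R) f t : continuous a ->
  (forall t, modulus (a t) <= M) -> funC0 a f t = a t * f t.
Proof.
move=> ca aM; apply: (@toC0E (fun t => a t * f t) f M).
  by move=> x; apply: continuousM; [exact: ca|exact: C0_continuous].
by move=> x; rewrite modulusM ler_wpM2r ?modulus_ge0.
Qed.

End C0_norms.

(** * Finite nets and precompactness in finite rank *)

Lemma compact_finite_net (T : topologicalType) (A : set T) (U : T -> set T) :
  compact A -> (forall x, A x -> nbhs x (U x)) ->
  exists2 s : seq T, (forall x, x \in s -> A x) &
    forall y, A y -> exists2 x, x \in s & U x y.
Proof.
move=> /compact_near_coveringP cA UA.
(* The filter of all sufficiently large finite lists: near-covering compactness along it yields one
   list that serves every point of [A]. *)
pose F : set_system (seq T) :=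
  [set V : set (seq T) |
    exists s0 : seq T, forall s : seq T, {subset s0 <= s} -> V s].
have FF : Filter F.
  split=> [|V W [s0 Vs] [s1 Ws]|V W VW [s0 Vs]].
  - by exists [::].
  - exists (s0 ++ s1) => s sub; split; [apply: Vs|apply: Ws] => x xs;
      by apply: sub; rewrite mem_cat xs ?orbT.
  - by exists s0 => s /Vs; exact: VW.
have [|s0 Hs0] := cA _ F (fun s y => exists2 x, x \in s & A x /\ U x y) FF.
  move=> x Ax; exists (U x, [set s : seq T | x \in s]) => /=.
    by split; [exact: UA|exists [:: x] => s; apply; rewrite mem_head].
  by move=> [y s] /= [Uxy xs]; exists x.
exists [seq x <- s0 | `[< A x >]].
  by move=> x; rewrite mem_filter => /andP[/asboolP].
move=> y /(Hs0 s0 (fun _ => id))[x xs [Ax Uxy]]; exists x => //.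
by rewrite mem_filter xs andbT; apply/asboolP.
Qed.

Section scalar_ball.
Context (R : realType) (k : scalar_kind).
Local Notation K := (scalars R k).

Lemma scalar_ball_compact (r : R) : compact [set z : K | modulus z <= r].
Proof.
have cl : closed [set z : K | modulus z <= r].
  rewrite [X in closed X](_ : _ = (@modulus R k) @^-1` [set x | x <= r])//.
  by apply: preimage_closed; [move=> z _; exact: modulus_continuous|exact: closed_le].
have : exists2 A : set K, compact A & [set z : K | modulus z <= r] `<=` A; last first.
  by move=> [A cA]; exact: subclosed_compact.
have segm := @segment_compact R (- r) r.
clear cl; rewrite /modulus; case: k => /=.
  by exists `[- r, r]%classic => // z /=; rewrite in_itv /= -ler_norml.
pose C : numFieldType := scalars R ComplexScalars.
pose rc : R -> C := @of_real R ComplexScalars; pose i : C := 'i%C.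
(* In the complex case the disc sits inside the continuous image of a square of real and imaginary
   parts. *)
exists ((fun z : R * R => rc z.1 + i * rc z.2) @`
    (`[- r, r]%classic `*` `[- r, r]%classic)).
  apply: continuous_compact; last exact: compact_setX.
  apply: continuous_subspaceT => z.
  have c1 : {for z, continuous (fun z : R * R => rc z.1)}.
    apply: (@continuous_comp _ _ C fst rc); first exact: cvg_fst.
    exact: of_real_continuous.
  have c2 : {for z, continuous (fun z : R * R => rc z.2)}.
    apply: (@continuous_comp _ _ C snd rc); first exact: cvg_snd.
    exact: of_real_continuous.
  by apply: cvgD c1 _; apply: cvgMl_tmp c2.
move=> [a b] /= zr; exists (a, b) => /=; last by simpc.
rewrite /= in_itv /= in_itv /= -!ler_norml.
split; apply: le_trans zr; rewrite -sqrtr_sqr ler_wsqrtr//.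
  by rewrite lerDl sqr_ge0.
by rewrite lerDr sqr_ge0.
Qed.

(** Induction on [s]: each new vector replaces A by the continuous image of disc x A under (z, w)
    |-> z v_i + w. *)
Lemma finite_rank_precompact (V : normedModType K) (I : eqType) (s : seq I)
    (v : I -> V) : exists2 A : set V, compact A &
  forall a : I -> K, (forall i, i \in s -> modulus (a i) <= 1) ->
    A (\sum_(i <- s) a i *: v i).
Proof.
elim: s => [|i s [A cA As]].
  by exists [set 0]; [exact: compact_set1|move=> a _; rewrite big_nil].
exists ((fun z : K * V => z.1 *: v i + z.2) @`
    ([set z : K | modulus z <= 1] `*` A)).
  apply: continuous_compact.
    apply: continuous_subspaceT => z; apply: cvgD; last exact: cvg_snd.
    by apply: cvgZr_tmp; exact: cvg_fst.
  by apply: compact_setX => //; exact: scalar_ball_compact.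
move=> a a1; rewrite big_cons.
exists (a i, \sum_(j <- s) a j *: v j) => //=; split=> /=.
  by rewrite a1// mem_head.
by apply: As => j js; rewrite a1// in_cons js orbT.
Qed.

End scalar_ball.

(** * Operator norms as genuine suprema, and weighted sums *)

Section operator_norms.
Context (R : realType) (k : scalar_kind).
Local Notation K := (scalars R k).
Local Notation rc := (@of_real R k).

Lemma opnorm_supP (V W : normedModType K) (F : V -> W) (M : K) :
  (forall x, `|x| <= 1 -> `|F x| <= M) ->
  supremums [set `|F x| | x in [set x : V | `|x| <= 1]] (opnorm F).
Proof.
move=> FM; apply: (@scalars_supP _ _ _ M).
  by exists `|F 0|, 0 => //=; rewrite normr0.
by move=> _ [x /= x1 <-]; rewrite normr_ge0 FM.
Qed.

Lemma opnorm_le (V W : normedModType K) (F : V -> W) (M : K) :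
  (forall x, `|x| <= 1 -> `|F x| <= M) -> opnorm F <= M.
Proof. by move=> FM; have [_] := opnorm_supP FM; apply=> _ [x /= /FM ? <-]. Qed.

Lemma le_opnorm (V W : normedModType K) (F : V -> W) (M : K) x :
  (forall x, `|x| <= 1 -> `|F x| <= M) -> `|x| <= 1 -> `|F x| <= opnorm F.
Proof. by move=> FM x1; have [+ _] := opnorm_supP FM; apply; exists x. Qed.

Lemma linear_from (V W : lmodType K) (F : V -> W) :
  (forall a f g, F (a *: f + g) = a *: F f + F g) ->
  exists t : {linear V -> W}, forall f, t f = F f.
Proof.
move=> Fl.
by exists (HB.pack_for {linear V -> W} F (GRing.isLinear.Build _ _ _ _ _ Fl)).
Qed.

(** The bound is asked only where [p i] is nonzero, as oscillation estimates hold only on the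
    supports of a partition. *)
Lemma modulus_sum_le (I : eqType) (s : seq I) (p : I -> R) (a : I -> K) (M : R) :
  (forall i, 0 <= p i) ->
  (forall i, i \in s -> p i != 0 -> modulus (a i) <= M) ->
  modulus (\sum_(i <- s) rc (p i) * a i) <= (\sum_(i <- s) p i) * M.
Proof.
move=> p0; elim: s => [|i s IHs] aM; first by rewrite !big_nil modulus0 mul0r.
rewrite !big_cons mulrDl; apply: le_trans (modulusD _ _) _.
apply: lerD; last by apply: IHs => j js; apply: aM; rewrite in_cons js orbT.
rewrite modulusM modulus_of_real ger0_norm//.
have [->|pi0] := eqVneq (p i) 0; first by rewrite !mul0r.
by rewrite ler_wpM2l// aM// mem_head.
Qed.

End operator_norms.

(** * Functionals, the set Pi and the numerical radius in real-valued terms *)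

Section C0_duality.
Context (R : realType) (k : scalar_kind) (L : topologicalType).
Local Notation K := (scalars R k).
Local Notation X := (C0 R k L).
Local Notation rc := (@of_real R k).
Local Notation re := (@re_scalar R k).

Lemma norm_le_supnorm (f : X) (r : R) : (`|f| <= rc r) = (supnorm f <= r).
Proof. by rewrite -of_real_supnorm le_of_real. Qed.

Lemma norm_le1_supnorm (f : X) : (`|f| <= 1) = (supnorm f <= 1).
Proof. by rewrite -(of_real1 R k) norm_le_supnorm. Qed.

(** The homogeneous [N] is left abstract to cover functionals ([modulus]) and operators ([supnorm])
    alike. *)
Lemma unit_ball_bound (V : lmodType K) (N : V -> R) (F : X -> V) (M : R) :
  (forall a v, N (a *: v) = modulus a * N v) ->
  (forall a f, F (a *: f) = a *: F f) ->
  (forall f, supnorm f <= 1 -> N (F f) <= M) ->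
  forall f, N (F f) <= M * supnorm f.
Proof.
move=> NZ FZ FM f; have [f0|f0] := eqVneq (supnorm f) 0.
  rewrite f0 mulr0 (supnorm_eq0 f0) -(scale0r (0 : X)) FZ NZ modulus0.
  by rewrite mul0r.
have fgt0 : 0 < supnorm f by rewrite lt_def f0 supnorm_ge0.
have := FM (rc (supnorm f)^-1 *: f).
rewrite supnormZ FZ NZ modulus_of_real ger0_norm ?invr_ge0 ?supnorm_ge0//.
by rewrite mulVf// lexx ler_pdivrMl// mulrC; apply.
Qed.

(** Rotating f makes t f real and nonnegative, so a bound on real parts bounds the modulus. *)
Lemma functional_bound (t : {linear X -> K^o}) (M : R) :
  (forall f, supnorm f <= 1 -> re (t f) <= M) ->
  forall f, modulus (t f) <= M * supnorm f.
Proof.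
move=> tM; apply: (unit_ball_bound (N := @modulus R k)) => [||f f1].
- exact: modulusM.
- by move=> a f; rewrite linearZ.
have [u u1 uE] := exists_rotation (t f).
rewrite -(re_of_real k (modulus (t f))) -uE -[u * _]/(u *: (t f : K^o)) -linearZ.
by apply: tM; rewrite supnormZ u1 mul1r.
Qed.

(** The inequality on [l] holds both continuity and operator norm at most one; the value 1 at the
    unit vector x forces the norm to be exactly one. *)
Lemma PiP (x : X) (l : {linear X -> K^o}) : Pi_set (x, l) <->
  [/\ supnorm x = 1, forall f, modulus (l f) <= supnorm f & l x = 1].
Proof.
have x1E : `|x| = 1 <-> supnorm x = 1.
  rewrite -of_real_supnorm -(of_real1 R k).
  by split=> [/(can_inj (@re_of_real R k))|->].
split=> [[/= /x1E x1 cl l1 lx]|[x1 l1 lx]]; split=> //=.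
- move=> f; rewrite -[leRHS]mul1r.
  apply: (unit_ball_bound (N := @modulus R k)) => [||{}f f1].
  + exact: modulusM.
  + by move=> a g; rewrite linearZ.
  have /linear_bounded_continuous/bounded_funP/(_ 1)[M lM] := cl.
  by rewrite modulus_le of_real1 -l1 (le_opnorm lM)// norm_le1_supnorm.
- exact/x1E.
- apply/linear_bounded_continuous/bounded_funP => r; exists r => f; apply: le_trans.
  by rewrite -of_real_modulus -of_real_supnorm le_of_real.
- have l1' f : `|f| <= 1 -> `|l f| <= 1.
    rewrite norm_le1_supnorm -of_real_modulus -(of_real1 R k) le_of_real.
    exact: le_trans.
  apply/eqP; rewrite eq_le opnorm_le//=.
  rewrite -[leLHS]normr1 -lx; apply: le_opnorm l1' _.
  by rewrite norm_le1_supnorm x1.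
Qed.

(** The a priori bound [M] ensures that [supremum] is a true least upper bound and not its default
    value 0. *)
Lemma numerical_radius_ub (T : {linear X -> X}) (M : R) p :
  (forall f, supnorm (T f) <= M * supnorm f) -> Pi_set p ->
  numerical_radius T = 1 -> modulus (p.2 (T p.1)) <= 1.
Proof.
move=> TM Pp T1; rewrite modulus_le of_real1 -T1.
have [] := @scalars_supP _ _ [set `|p.2 (T p.1)| | p in @Pi_set K X] (rc M).
- by exists `|p.2 (T p.1)|, p.
- move=> _ [[x l] /PiP[x1 l1 lx] <-] /=; rewrite normr_ge0 /=.
  rewrite -of_real_modulus le_of_real (le_trans (l1 _))// (le_trans (TM _))//.
  by rewrite x1 mulr1.
- by move=> + _; apply; exists p.
Qed.

Lemma numerical_radius1 (S : {linear X -> X}) p :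
  (forall f, supnorm (S f) <= supnorm f) -> Pi_set p ->
  modulus (p.2 (S p.1)) = 1 -> numerical_radius S = 1.
Proof.
move=> S1 Pp Sp.
have Sub q : Pi_set q -> `|q.2 (S q.1)| <= 1.
  case: q => y g /PiP[y1 g1 gy] /=.
  rewrite -of_real_modulus -(of_real1 R k) le_of_real (le_trans (g1 _))//.
  by rewrite (le_trans (S1 _))// y1.
have [|_ [q Pq <-]|ub lub] :=
    @scalars_supP _ _ [set `|p.2 (S p.1)| | p in @Pi_set K X] 1.
- by exists `|p.2 (S p.1)|, p.
- by rewrite normr_ge0 Sub.
apply/eqP; rewrite eq_le; apply/andP; split.
  by apply: lub => _ [q Pq <-]; exact: Sub.
by apply: ub; exists p => //; rewrite -of_real_modulus Sp of_real1.
Qed.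

Definition totally_bounded_C0 (B : set X) : Prop :=
  forall th : R, 0 < th -> exists gs : seq X,
    forall b, B b -> exists2 g, g \in gs & supnorm (b - g) <= th.

Lemma precompact_totally_bounded (B : set X) :
  precompact B -> totally_bounded_C0 B.
Proof.
rewrite precompactE => cB th th0.
have th0' : 0 < rc th by rewrite -(of_real0 R k) lt_of_real.
have [|gs _ gsB] := @compact_finite_net _ _ (fun g : X => ball g (rc th)) cB.
  by move=> g _; exact: nbhsx_ballx.
exists gs => b /subset_closure/gsB[g ggs]; rewrite -ball_normE /= => gb.
by exists g; rewrite // -norm_le_supnorm distrC ltW.
Qed.

Lemma totally_bounded_bounded (B : set X) : totally_bounded_C0 B ->
  exists2 M : R, 0 <= M & forall b, B b -> supnorm b <= M.
Proof.
move=> /(_ 1 ltr01)[gs Bgs]; exists (1 + \sum_(g <- gs) supnorm g) => [|b /Bgs].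
  by rewrite addr_ge0// sumr_ge0// => g _; exact: supnorm_ge0.
move=> [g ggs bg]; rewrite -(subrK g b); apply: le_trans (supnormD _ _) _.
rewrite lerD// (big_rem _ ggs)/= lerDl sumr_ge0// => h _.
exact: supnorm_ge0.
Qed.

End C0_duality.

(** * Numerical index one *)

Section C0_bumps.
Context (R : realType) (k : scalar_kind) (L : topologicalType).
Local Notation K := (scalars R k).
Local Notation X := (C0 R k L).
Local Notation rc := (@of_real R k).
Local Notation re := (@re_scalar R k).
Implicit Types (f g x : X) (t : L).

Lemma modulus_C0_continuous f (z : K) : continuous (fun t => modulus (f t - z)).
Proof.
move=> t; apply: (@continuous_comp _ _ _ (fun t => f t - z) (@modulus R k)).
  by apply: cvgB; [exact: C0_continuous|exact: cvg_cst].
exact: modulus_continuous.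
Qed.

Lemma of_real_comp_continuous (p : L -> R) : continuous p ->
  continuous (fun t => rc (p t)).
Proof.
by move=> cp t; apply: continuous_comp; [exact: cp|exact: of_real_continuous].
Qed.

(** Suppose |T f t| = m > 1 with |f| <= 1. Near t, f can be replaced by any unimodular constant z
    without leaving the ball; the result F z and conj(z) times evaluation at t form a pair in Pi, so
    |T (F z) t| <= 1. Up to a small error f is a convex combination of two such F z, which
    contradicts m > 1. *)
Lemma numerical_radius_norm (T : {linear X -> X}) (M : R) :
  (forall f, supnorm (T f) <= M * supnorm f) ->
  (forall p, Pi_set p -> modulus (p.2 (T p.1)) <= 1) ->
  forall f, supnorm (T f) <= supnorm f.
Proof.
move=> TM T1 f; rewrite -[leRHS]mul1r.
apply: (unit_ball_bound (N := @supnorm R k L) (F := T)) => [||{}f f1].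
- exact: supnormZ.
- by move=> a g; rewrite linearZ.
apply: supnorm_le => // t; rewrite leNgt; apply/negP => Tft.
pose m := modulus (T f t); have m0 : 0 < m by rewrite (lt_trans ltr01).
pose M1 := `|M| + 1; have M1gt0 : 0 < M1 by rewrite ltr_wpDl.
(* Chosen so that M1 e = (m - 1) / 2, half of the excess to be contradicted. *)
pose e := (m - 1) / (2 * M1).
have e0 : 0 < e by rewrite divr_gt0 ?mulr_gt0// subr_gt0.
(* A bump with value 1 at t. The first factor confines it to points where f is within e of f t; the
   second is dominated by a multiple of |T f|, which puts the bump in C_0(L). *)
pose p s := Num.max 0 (1 - modulus (f s - f t) / e) *
  Num.min 1 (modulus (T f s) / m).
have pmax s : 0 <= Num.max 0 (1 - modulus (f s - f t) / e) <= 1.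
  rewrite le_max lexx ge_max ler01 /= gerBl divr_ge0 ?modulus_ge0//; exact: ltW.
have pmin s : 0 <= Num.min 1 (modulus (T f s) / m) <= 1.
  rewrite le_min ler01 ge_min lexx /= andbT divr_ge0 ?modulus_ge0//; exact: ltW.
have p0 s : 0 <= p s.
  by rewrite mulr_ge0//; [case/andP: (pmax s)|case/andP: (pmin s)].
have p1 s : p s <= 1.
  have /andP[? ?] := pmax s; have /andP[? ?] := pmin s.
  by rewrite -[leRHS]mul1r ler_pM.
have pT s : p s <= m^-1 * modulus (T f s).
  have /andP[? ?] := pmax s; have /andP[? _] := pmin s.
  rewrite mulrC -[leRHS]mul1r ler_pM//; by rewrite ge_min lexx orbT.
have pt : p t = 1.
  rewrite /p subrr modulus0 mul0r subr0 divff ?gt_eqF// minxx.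
  by rewrite mulr1; apply/max_idPr.
have pf s : p s * modulus (f s - f t) <= e.
  have /andP[? ?] := pmax s; have /andP[? ?] := pmin s.
  have [fs|fs] := leP (modulus (f s - f t)) e.
    by rewrite -[leRHS]mul1r ler_pM// modulus_ge0.
  rewrite /p (_ : Num.max _ _ = 0) ?mul0r ?ltW//; apply/max_idPl.
  by rewrite subr_le0 ler_pdivlMr// mul1r ltW.
have cp : continuous p.
  have cTf : continuous (fun s => modulus (T f s) / m).
    have cT : continuous (fun s => modulus (T f s)).
      by have := @modulus_C0_continuous (T f) 0; under eq_fun do rewrite subr0.
    by move=> s; apply: cvgM; [exact: cT|exact: cvg_cst].
  have cf : continuous (fun s => 1 - modulus (f s - f t) / e).
    move=> s; apply: cvgB; first exact: cvg_cst.
    by apply: cvgM; [exact: modulus_C0_continuous|exact: cvg_cst].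
  have c0 (r : R) : continuous (fun _ : L => r) by move=> s; exact: cst_continuous.
  move=> s; apply: cvgM; first exact: (continuous_maxr (c0 0) cf).
  exact: (continuous_minr (c0 1) cTf).
have crp := of_real_comp_continuous cp.
pose P : X := toC0 (fun s => rc (p s)).
have PE s : P s = rc (p s).
  apply: (@toC0E _ _ _ _ (T f) m^-1) => // s'.
  by rewrite modulus_of_real ger0_norm.
pose Pf : X := funC0 (fun s => rc (p s)) f.
have PfE s : Pf s = rc (p s) * f s.
  apply: (@funC0E _ _ _ _ 1) => // s'.
  by rewrite modulus_of_real ger0_norm.
pose F z : X := f - Pf + z *: P.
have FE z s : F z s = rc (1 - p s) * f s + rc (p s) * z.
  by rewrite C0DE C0BE C0ZE PE PfE of_realB of_real1 mulrBl mul1r [z * _]mulrC.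
have F1 z s : modulus z = 1 -> modulus (F z s) <= 1.
  move=> z1; rewrite FE; apply: le_trans (modulusD _ _) _.
  rewrite !modulusM !modulus_of_real z1 mulr1 !ger0_norm ?subr_ge0//.
  have : modulus (f s) <= 1 by apply: le_trans (le_supnorm _ _) f1.
  have := p0 s; have := p1 s; nra.
have TF z : modulus z = 1 -> modulus (T (F z) t) <= 1.
  move=> z1; have zz : conj_scalar z * z = 1.
    by rewrite mulrC mul_conj_scalar z1 expr1n of_real1.
  have [l lE] : exists l : {linear X -> K^o},
      forall g, l g = conj_scalar z * g t.
    by apply: linear_from => a g g'; rewrite C0DE C0ZE mulrDr mulrCA.
  have Ft : F z t = z by rewrite FE pt subrr of_real0 of_real1 mul0r mul1r add0r.
  have /T1 : Pi_set (F z, l).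
    apply/PiP; split=> [|g|]; last by rewrite lE Ft.
      apply/eqP; rewrite eq_le; apply/andP; split.
        by apply: supnorm_le => // s; exact: F1.
      by rewrite -z1 -{1}Ft le_supnorm.
    by rewrite lE modulusM modulus_conj z1 mul1r le_supnorm.
  by rewrite /= lE modulusM modulus_conj z1 mul1r.
have [r [z1 [z2 [/andP[r0 r1] m1 m2 fE]]]] : exists r z1 z2,
  [/\ 0 <= r <= 1, modulus z1 = 1, modulus z2 = 1 &
      f t = rc r * z1 + rc (1 - r) * z2].
  by apply: modulus_conv_unit; apply: le_trans (le_supnorm _ _) f1.
(* With f t = r z1 + (1 - r) z2, the combination of F z1 and F z2 equals f - p f + f t p; the
   remainder p (f - f t) has norm at most e. *)
have fdec : f = rc r *: F z1 + rc (1 - r) *: F z2 + (Pf - f t *: P).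
  apply/val_inj/funext => s.
  transitivity (rc r * F z1 s + rc (1 - r) * F z2 s + (Pf s - f t * P s)) => //.
  rewrite !FE PfE PE fE !of_realB of_real1 -[val f s]/(f s); ring.
have small : supnorm (Pf - f t *: P) <= e.
  apply: supnorm_le => [|s]; first exact: ltW.
  rewrite C0BE C0ZE PfE PE [f t * _]mulrC -mulrBr modulusM modulus_of_real.
  by rewrite ger0_norm.
have : m <= r * 1 + (1 - r) * 1 + M1 * e.
  move: small fdec; set D := Pf - _ => small fdec; clearbody F D.
  rewrite /m {1}fdec !linearD !linearZ /=.
  rewrite -[_ t]/(rc r * T (F z1) t + rc (1 - r) * T (F z2) t + T D t).
  apply: le_trans (modulusD _ _) _; apply: lerD.
    apply: le_trans (modulusD _ _) _.
    rewrite !modulusM !modulus_of_real ger0_norm// [`|1 - r|]ger0_norm ?subr_ge0//.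
    by rewrite lerD// ler_wpM2l ?subr_ge0// TF.
  apply: le_trans (le_supnorm _ _) (le_trans (TM _) _).
  apply: le_trans (ler_wpM2l (ltW M1gt0) small); rewrite ler_wpM2r ?supnorm_ge0//.
  by rewrite (le_trans (ler_norm _))// lerDl.
rewrite /e; have -> : M1 * ((m - 1) / (2 * M1)) = (m - 1) / 2.
  by field; rewrite gt_eqF.
have : 1 < m by []; lra.
Qed.

End C0_bumps.

(** * Finite partitions of unity adapted to totally bounded sets *)

Section partitions.
Context (R : realType) (k : scalar_kind) (L : topologicalType).
Local Notation K := (scalars R k).
Local Notation X := (C0 R k L).
Local Notation rc := (@of_real R k).
Implicit Types (f g x : X) (t c : L).

Lemma compact_some_large (gs : seq X) (r : R) : 0 < r ->
  compact [set t | has (fun g : X => r <= modulus (g t)) gs].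
Proof.
move=> r0; elim: gs => [|g gs IH] /=.
  rewrite [X in compact X](_ : _ = set0); first exact: compact0.
  by apply/seteqP; split.
rewrite [X in compact X](_ : _ = [set t | rc r <= `|g t|] `|`
    [set t | has (fun g : X => r <= modulus (g t)) gs]).
  by apply: compactU IH; apply: C0_vanish; rewrite -(of_real0 R k) lt_of_real.
apply/seteqP; split => t /=; rewrite -of_real_modulus le_of_real.
  by move=> /orP[]; [left|right].
by move=> [|] ->; rewrite ?orbT.
Qed.

Lemma continuous_sumr (I : Type) (s : seq I)
    (F : I -> L -> R) : (forall i, continuous (F i)) ->
  continuous (fun t => \sum_(i <- s) F i t).
Proof.
move=> cF; elim: s => [|i s IHs] t.
  under eq_fun do rewrite big_nil; exact: cst_continuous.
under eq_fun do rewrite big_cons.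
by apply: cvgD; [exact: cF|exact: IHs].
Qed.

(** Only the compact set where some member of [gs] reaches 3 th is covered; elsewhere all members
    are small, whence the alternative in the last clause. *)
Lemma finite_partition (gs : seq X) (th : R) : 0 < th ->
  exists (s : seq L) (p : L -> L -> R) (P : L -> X),
  [/\ forall c t, c \in s -> P c t = rc (p c t),
      forall c t, 0 <= p c t,
      forall t, \sum_(c <- s) p c t <= 1,
      forall c t g, p c t != 0 -> g \in gs -> modulus (g t - g c) <= 2 * th &
      forall t, \sum_(c <- s) p c t = 1 \/
        forall g, g \in gs -> modulus (g t) <= 3 * th].
Proof.
move=> th0.
pose d c t := \sum_(g <- gs) modulus (g t - g c).
have cd c : continuous (d c).
  by apply: continuous_sumr => g; exact: modulus_C0_continuous.
have d0 c t : 0 <= d c t by apply: sumr_ge0 => g _; exact: modulus_ge0.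
have dg c t g : g \in gs -> modulus (g t - g c) <= d c t.
  move=> ggs; rewrite /d (big_rem _ ggs) /= lerDl sumr_ge0// => h _.
  exact: modulus_ge0.
have dcc c : d c c = 0.
  by rewrite /d big1// => g _; rewrite subrr modulus0.
have [|c Ac|s sA As] := @compact_finite_net L
    [set t | has (fun g : X => 3 * th <= modulus (g t)) gs]
    (fun c => [set t | d c t < th]).
- by apply: compact_some_large; rewrite mulr_gt0.
- have /(cvgrPdist_lt (FF := nbhs_filter c))/(_ _ th0) := cd c c.
  apply: filterS => t; rewrite dcc sub0r normrN.
  by rewrite ger0_norm.
pose a c t := Num.max 0 (2 * th - d c t).
have a0 c t : 0 <= a c t by rewrite le_max lexx.
have cst (r : R) : continuous (fun _ : L => r) by move=> t; exact: cst_continuous.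
have ca c : continuous (a c).
  apply: (continuous_maxr (cst 0)) => t.
  by apply: cvgB; [exact: cst|exact: cd].
(* The floor th keeps the quotient continuous everywhere and is inactive on the covered set: d c t <
   th for one c already makes the sum exceed th. *)
pose w t := Num.max (\sum_(c <- s) a c t) th.
have w0 t : 0 < w t by rewrite lt_max th0 orbT.
have cw : continuous w.
  by apply: (continuous_maxr _ (cst th)); exact: continuous_sumr.
pose p c t := a c t / w t.
have cp c : continuous (p c).
  move=> t; apply: cvgM; first exact: ca.
  by apply: continuousV; [rewrite gt_eqF|exact: cw].
have p0 c t : 0 <= p c t by rewrite divr_ge0// ltW.
have psum t : \sum_(c <- s) p c t = (\sum_(c <- s) a c t) / w t.
  by rewrite mulr_suml.
have ps1 t : \sum_(c <- s) p c t <= 1.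
  by rewrite psum ler_pdivrMr// mul1r le_max lexx.
have pd c t : p c t != 0 -> d c t <= 2 * th.
  apply: contra_neqT; rewrite -ltNge => dct.
  by rewrite /p /a (_ : Num.max _ _ = 0) ?mul0r//; apply/max_idPl; lra.
exists s, p, (fun c => toC0 (fun t => rc (p c t))); split=> //.
(* Some g has |g c| >= 3 th and varies by at most 2 th on the support of p c, so there |g| >= th;
   thus th^-1 |g| dominates p c, which vanishes at infinity. *)
- move=> c t cs; have /hasP[g ggs gc] := sA _ cs.
  apply: (@toC0E _ _ _ _ g th^-1).
    exact: of_real_comp_continuous.
  move=> u; rewrite modulus_of_real ger0_norm//.
  have [->|pcu] := eqVneq (p c u) 0.
    by rewrite mulr_ge0 ?modulus_ge0// invr_ge0 ltW.
  have := dg c u g ggs; have := pd _ _ pcu; have := modulusD (g c - g u) (g u).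
  rewrite subrK modulusBC => ? ? ?.
  apply: (@le_trans _ _ 1).
    apply: le_trans (ps1 u); rewrite (big_rem _ cs) /= lerDl sumr_ge0//.
  by rewrite mulrC ler_pdivlMr// mul1r; lra.
- by move=> c t g /pd dct ggs; apply: le_trans dct; exact: dg.
move=> t; have [/As[c cs /= dct]|/hasPn tgs] :=
    boolP (has (fun g : X => 3 * th <= modulus (g t)) gs); [left|right].
  rewrite psum /w (_ : Num.max _ _ = \sum_(c <- s) a c t).
    rewrite divff// gt_eqF// (big_rem _ cs) /= ltr_wpDr ?sumr_ge0//.
    by rewrite lt_max; apply/orP; right; lra.
  apply/max_idPl; rewrite (big_rem _ cs) /= ler_wpDr ?sumr_ge0//.
  by rewrite le_max; apply/orP; right; lra.
by move=> g /tgs; rewrite -ltNge => /ltW.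
Qed.

Lemma totally_bounded_partition (B : set X) (th : R) :
  totally_bounded_C0 B -> 0 < th ->
  exists (s : seq L) (p : L -> L -> R) (P : L -> X),
  [/\ forall c t, c \in s -> P c t = rc (p c t),
      forall c t, 0 <= p c t,
      forall t, \sum_(c <- s) p c t <= 1,
      forall c t g, p c t != 0 -> B g -> modulus (g t - g c) <= th &
      forall t, \sum_(c <- s) p c t = 1 \/ forall g, B g -> modulus (g t) <= th].
Proof.
(* Passing to the net and back costs 2 th / 5, on top of the oscillation 2 th / 5; the smallness
   alternative costs th / 5 + 3 th / 5. *)
move=> tB th0; have th5 : 0 < th / 5 by rewrite divr_gt0.
have [gs gsB] := tB _ th5.
have [s [p [P [PE p0 p1 pgs ps]]]] := finite_partition gs th5.
exists s, p, P; split=> //.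
  move=> c t g pct /gsB[h hgs gh]; have := pgs c t h pct hgs.
  have := modulusD (g t - h t) (h t - g c).
  have := modulusD (h t - h c) (h c - g c).
  rewrite !addrA !subrK (modulusBC (h c)).
  have := le_trans (le_supnorm (g - h) t) gh.
  have := le_trans (le_supnorm (g - h) c) gh; rewrite !C0BE; lra.
move=> t; have [|gst] := ps t; [by left|right=> g /gsB[h /gst ht gh]].
have := modulusD (g t - h t) (h t); rewrite subrK.
have := le_trans (le_supnorm (g - h) t) gh; rewrite !C0BE; lra.
Qed.

End partitions.

(** * Moving a functional that almost attains its norm at x to one attaining it at y *)

Section perturbed_functionals.
Context (R : realType) (k : scalar_kind) (L : topologicalType).
Local Notation K := (scalars R k).
Local Notation X := (C0 R k L).
Local Notation rc := (@of_real R k).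
Local Notation re := (@re_scalar R k).
Implicit Types (f g x : X) (t c : L).

(** For |x| <= 1 the quotient x / max(|x|, 1 - b) is unimodular where |x| >= 1 - b; the floor 1 - b
    makes the multiplier continuous and bounded. *)
Definition push_to_sphere (b : R) x : X :=
  funC0 (fun t => rc (Num.max (modulus (x t)) (1 - b))^-1) x.

Section push.
Variables (b : R) (x : X).
Hypotheses (b0 : 0 < b) (b2 : b <= 1 / 2) (x1 : supnorm x <= 1).
Let m t : R := Num.max (modulus (x t)) (1 - b).
Let y := push_to_sphere b x.

Let xt1 t : modulus (x t) <= 1. Proof. exact: le_trans (le_supnorm _ _) x1. Qed.

Let m_bounds t : [/\ 1 - b <= m t, m t <= 1, 0 < b & b <= 1 / 2].
Proof.
suff /andP[] : 1 - b <= m t <= 1 by [].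
by rewrite /m le_max lexx orbT ge_max xt1 lerBlDr lerDl ltW.
Qed.

Let m_gt0 t : 0 < m t.
Proof. by have [? ? ? ?] := m_bounds t; lra. Qed.

Lemma push_to_sphereE t : y t = rc (m t)^-1 * x t.
Proof.
apply: (@funC0E _ _ _ _ 2) => u.
  apply: of_real_comp_continuous => {}u; apply: (@continuousV R L m u).
    by rewrite gt_eqF// m_gt0.
  have cx : continuous (fun t => modulus (x t)).
    by have := @modulus_C0_continuous _ _ _ x 0; under eq_fun do rewrite subr0.
  by apply: (continuous_maxr cx) => {}u; exact: cst_continuous.
rewrite modulus_of_real ger0_norm ?invr_ge0; last exact: ltW (m_gt0 u).
rewrite -[leRHS]invrK lef_pV2 ?posrE ?invr_gt0//; last exact: m_gt0.
by have [] := m_bounds u; rewrite /m; lra.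
Qed.

Lemma push_to_sphereK t : x t = rc (m t) * y t.
Proof.
by rewrite push_to_sphereE mulrA -of_realM mulfV ?gt_eqF// of_real1 mul1r.
Qed.

Lemma push_to_sphere_unit t : 1 - b <= modulus (x t) -> modulus (y t) = 1.
Proof.
move=> /max_idPl mE; have := m_gt0 t.
rewrite push_to_sphereE modulusM modulus_of_real /m mE => x0.
by rewrite ger0_norm ?invr_ge0 ?ltW// mulVf// gt_eqF.
Qed.

Lemma push_to_sphere_le1 t : modulus (y t) <= 1.
Proof.
have := m_gt0 t => m0.
rewrite push_to_sphereE modulusM modulus_of_real ger0_norm ?invr_ge0 ?(ltW m0)//.
by rewrite mulrC ler_pdivrMr// mul1r le_max lexx.
Qed.

Lemma push_to_sphere_norm : supnorm y <= 1.
Proof. by apply: supnorm_le => // t; exact: push_to_sphere_le1. Qed.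

Lemma push_to_sphere_dist t : modulus (x t - y t) <= b.
Proof.
rewrite push_to_sphereK -[X in _ - X]mul1r -of_real1 -mulrBl -of_realB modulusM.
rewrite modulus_of_real ler0_norm; last by have [? ? ? ?] := m_bounds t; lra.
have := push_to_sphere_le1 t; have := modulus_ge0 (y t); have [? ? ? ?] := m_bounds t; nra.
Qed.

(** 2 x - y = (2 m - 1) y with 0 <= 2 m - 1 <= 1. Thus x is a midpoint of y and another function in
    the ball, and a contractive functional with value 1 at x has value 1 at y too. *)
Lemma push_to_sphere_reflect t : modulus (x t - (y t - x t)) <= 1.
Proof.
have -> : x t - (y t - x t) = rc (2 * m t - 1) * y t.
  rewrite of_realB of_realM of_real1 push_to_sphereK.
  rewrite (_ : rc 2 = 2); last by rewrite -[2]/(1 + 1) of_realD of_real1.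
  by ring.
rewrite modulusM modulus_of_real ger0_norm; last by have [? ? ? ?] := m_bounds t; lra.
have := push_to_sphere_le1 t; have := modulus_ge0 (y t); have [? ? ? ?] := m_bounds t; nra.
Qed.

Section supporting.
Variable t0 : L.
Hypothesis xt0 : 1 - b <= modulus (x t0).

Let A : set L := [set t | 1 - b <= modulus (x t)].
Let E f : set R := [set re (f t * conj_scalar (y t)) | t in A].
(** A linear functional whose real part is below p is contractive, as |p f| <= |f|, and takes the
    value 1 at y, as p (- y) <= -1. *)
Let p f := sup (E f).

Let reb f t : `|re (f t * conj_scalar (y t))| <= supnorm f.
Proof.
apply: le_trans (norm_re_scalar_le _) _; rewrite modulusM modulus_conj.
apply: le_trans (le_supnorm f t); rewrite -[leRHS]mulr1.
by rewrite ler_wpM2l ?modulus_ge0 ?push_to_sphere_le1.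
Qed.

Let E0 f : E f !=set0.
Proof. by exists (re (f t0 * conj_scalar (y t0))), t0. Qed.

Let le_p f t : A t -> re (f t * conj_scalar (y t)) <= p f.
Proof.
move=> At; apply: ub_le_sup; last by exists t.
by exists (supnorm f) => _ [u _ <-]; exact: le_trans (ler_norm _) (reb _ _).
Qed.

Let p_le f (r : R) : (forall t, A t -> re (f t * conj_scalar (y t)) <= r) ->
  p f <= r.
Proof. by move=> fr; apply: ge_sup => // _ [t At <-]; exact: fr. Qed.

Let p_norm f : `|p f| <= supnorm f.
Proof.
rewrite ler_norml; apply/andP; split.
  apply: le_trans (le_p f xt0); have := reb f t0.
  by rewrite ler_norml => /andP[].
by apply: p_le => t _; exact: le_trans (ler_norm _) (reb _ _).
Qed.

Let p_sublinear : sublinear p.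
Proof.
split=> [f g|r f r0]; apply: p_le => t At.
  by rewrite C0DE mulrDl re_scalarD lerD// le_p.
by rewrite C0ZE -mulrA re_scalarM ler_wpM2l ?le_p// ltW.
Qed.

Let p_push : p (- y) <= - 1.
Proof.
apply: p_le => t At.
by rewrite C0NE mulNr re_scalarN -modulus_sqr push_to_sphere_unit// expr1n.
Qed.

Variable tau : {linear X -> K^o}.
Hypothesis tau1 : forall f, modulus (tau f) <= supnorm f.
Hypothesis taux : 1 - b ^+ 2 / 4 <= re (tau x).

(* Evaluate tau at x + s f with s = b / 2: where |x| < 1 - b this has modulus
   at most 1 - s, and elsewhere at most 1 + s p f + s ^ 2. *)
Let tau_le_unit f : supnorm f <= 1 -> re (tau f) <= p f + b.
Proof.
move=> f1; pose s := b / 2; set M := p f; have b2' := b2.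
have s0 : 0 < s by rewrite divr_gt0.
have s4 : s <= 1 / 4 by rewrite /s; lra.
have bE : b = 2 * s by rewrite /s; field.
have MM : `|M| <= 1 by apply: le_trans f1; exact: p_norm.
have M1 : -1 <= M <= 1 by rewrite -ler_norml.
have N0 : 0 <= 1 + s * M + s ^+ 2 by nra.
have xf : supnorm (x + rc s *: f) <= 1 + s * M + s ^+ 2.
  apply: supnorm_le => // t; rewrite C0DE C0ZE.
  have ft1 : modulus (f t) <= 1 by apply: le_trans f1; exact: le_supnorm.
  have [At|nAt] := leP (1 - b) (modulus (x t)); last first.
    apply: le_trans (modulusD _ _) _.
    rewrite modulusM modulus_of_real ger0_norm ?(ltW s0)//.
    have := modulus_ge0 (f t); nra.
  rewrite -ler_sqr ?nnegrE ?modulus_ge0// modulus_sqrD.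
  have fx : re (f t * conj_scalar (x t)) <= modulus (x t) * M.
    have mx : m t = modulus (x t) by rewrite /m; exact/max_idPl.
    rewrite {1}push_to_sphereK conj_scalarM conj_of_real mulrCA re_scalarM mx.
    by rewrite ler_wpM2l ?modulus_ge0// le_p.
  set a := modulus (x t) in fx *; have a1 : a <= 1 by exact: xt1.
  have ab : 1 - 2 * s <= a by rewrite -bE.
  have ff : modulus (f t) ^+ 2 <= 1.
    by rewrite expr_le1// modulus_ge0.
  apply: (@le_trans _ _ (a ^+ 2 + 2 * s * (a * M) + s ^+ 2 * 1)).
    rewrite lerD ?lerD2l ?ler_wpM2l ?sqr_ge0//.
    by rewrite mulr_ge0// ltW.
  have h1 : (a + s * M) ^+ 2 <= (1 + s * M) ^+ 2.
    by rewrite ler_sqr ?nnegrE ?lerD2r//; nra.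
  have h2 : 0 <= M ^+ 2 by exact: sqr_ge0.
  have h3 : 0 <= s ^+ 2 by exact: sqr_ge0.
  have h4 : 0 <= s ^+ 2 * M ^+ 2 by exact: mulr_ge0.
  (* Since |s M| <= 1 / 4, the cross term 2 s^2 (1 + s M) of the square is at least (3 / 2) s^2 and
     absorbs the s^2 coming from |s f|^2. *)
  have h5 : 3 / 4 <= 1 + s * M by nra.
  have h6 : s ^+ 2 * (3 / 4) <= s ^+ 2 * (1 + s * M) by rewrite ler_wpM2l.
  have h7 : 0 <= (s ^+ 2) ^+ 2 by exact: sqr_ge0.
  have -> : (1 + s * M + s ^+ 2) ^+ 2 = (1 + s * M) ^+ 2 +
    2 * (s ^+ 2 * (1 + s * M)) + (s ^+ 2) ^+ 2 by ring.
  have -> : a ^+ 2 + 2 * s * (a * M) + s ^+ 2 * 1 =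
    (a + s * M) ^+ 2 - s ^+ 2 * M ^+ 2 + s ^+ 2 by ring.
  lra.
(* Here re (tau x) >= 1 - s^2, so s re (tau f) <= s M + 2 s^2, and 2 s = b. *)
have := le_trans (re_scalar_le _) (le_trans (tau1 _) xf).
rewrite linearD linearZ re_scalarD re_scalarM.
have : b ^+ 2 / 4 = s ^+ 2 by rewrite bE; field.
move: taux => + bs; rewrite bs bE => ? ?.
rewrite -(ler_pM2l s0); lra.
Qed.

Let tau_le f : re (tau f) <= p f + b * supnorm f.
Proof.
have [f0|fn0] := eqVneq (supnorm f) 0.
  rewrite f0 (supnorm_eq0 f0) linear0 mulr0 addr0 (sublinear0 p_sublinear).
  by rewrite -(of_real0 R k) re_of_real.
have f0 : 0 < supnorm f by rewrite lt_def fn0 supnorm_ge0.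
have fi0 : 0 <= (supnorm f)^-1 by rewrite invr_ge0 ltW.
have := @tau_le_unit (rc (supnorm f)^-1 *: f).
rewrite supnormZ modulus_of_real ger0_norm// mulVf// lexx => /(_ isT).
rewrite linearZ re_scalarM (sublinearZ p_sublinear)// -(ler_pM2l f0).
by rewrite mulrDr !mulVKf// [supnorm f * b]mulrC.
Qed.

(* The infimal convolution of p and f |-> re (tau f) + b |f| is sublinear, and
   it is finite precisely because re tau <= p + b |.| . *)
Lemma perturbed_functional : exists2 tau' : {linear X -> K^o},
  (forall f, modulus (tau' f) <= supnorm f) /\ tau' y = 1 &
  forall f, modulus (tau' f - tau f) <= b * supnorm f.
Proof.
have [pD pZ] := p_sublinear.
pose F f g := p g + (re (tau (f - g)) + b * supnorm (f - g)).
pose G f := range (F f).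
have G0 f : G f !=set0 by exists (F f 0), 0.
have Glb f : has_lbound (G f).
  exists (re (tau f) - b * supnorm f) => _ [g _ <-]; rewrite /F.
  have := tau_le g; rewrite linearB re_scalarB.
  have : b * supnorm g <= b * (supnorm (f - g) + supnorm f).
    rewrite ler_wpM2l ?(ltW b0)// -[supnorm (f - g)]supnormN opprB.
    by have := supnormD (g - f) f; rewrite subrK.
  lra.
have qF f g : inf (G f) <= F f g by apply: ge_inf => //; exists g.
have sq : sublinear (fun f => inf (G f)).
  split=> [f1 f2|r f r0].
    apply: le_infD => // _ _ [g1 _ <-] [g2 _ <-].
    apply: le_trans (qF _ (g1 + g2)) _; rewrite /F opprD addrACA linearD.
    rewrite re_scalarD; have := pD g1 g2.
    have : b * supnorm (f1 - g1 + (f2 - g2)) <=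
        b * (supnorm (f1 - g1) + supnorm (f2 - g2)).
      by rewrite ler_wpM2l ?(ltW b0)// supnormD.
    lra.
  apply: inf_le_pmul => // _ [g _ <-].
  apply: le_trans (qF _ (rc r *: g)) _; rewrite /F -scalerBr linearZ re_scalarM.
  rewrite supnormZ modulus_of_real ger0_norm ?(ltW r0)//.
  have := pZ r g r0; lra.
have [tau' tq] := hahn_banach sq.
(* In the infimal convolution, g = f gives domination by p; further down, g = 0 gives distance at
   most b from [tau]. *)
have tp f : re (tau' f) <= p f.
  apply: le_trans (tq f) (le_trans (qF _ f) _).
  by rewrite /F subrr linear0 supnorm0 mulr0 -(of_real0 R k) re_of_real !addr0.
have t1 f : modulus (tau' f) <= supnorm f.
  rewrite -[leRHS]mul1r; apply: functional_bound => {}f f1.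
  exact: le_trans (tp f) (le_trans (ler_norm _) (le_trans (p_norm f) f1)).
exists tau'; first split=> //.
  have y1 : modulus (tau' y) <= 1 by apply: le_trans (t1 _) push_to_sphere_norm.
  rewrite -(of_real1 R k); apply: eq_of_real => //.
  apply/eqP; rewrite eq_le (le_trans (re_scalar_le _) y1)/=.
  by have := le_trans (tp (- y)) p_push; rewrite linearN re_scalarN lerN2.
move=> f; have [D DE] : exists D : {linear X -> K^o},
    forall f, D f = tau' f - tau f.
  apply: linear_from => a g h.
  by rewrite !linearD !linearZ /= addrACA.
rewrite -DE; apply: functional_bound => {}f f1.
rewrite DE re_scalarB lerBlDl; apply: le_trans (tq f) (le_trans (qF f 0) _).
rewrite /F subr0 (sublinear0 p_sublinear) add0r lerD2l -[leRHS]mulr1.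
by rewrite ler_wpM2l// (ltW b0).
Qed.

End supporting.
End push.
End perturbed_functionals.

(** * Cutting a functional off to the set where it is almost carried *)

Section localized_functionals.
Context (R : realType) (k : scalar_kind) (L : topologicalType).
Local Notation K := (scalars R k).
Local Notation X := (C0 R k L).
Local Notation rc := (@of_real R k).
Local Notation re := (@re_scalar R k).

Definition cutoff (u : L -> R) (f : X) : X := funC0 (fun t => rc (u t)) f.

Lemma cutoffE (u : L -> R) (f : X) t : continuous u -> (forall t, 0 <= u t <= 1) ->
  cutoff u f t = rc (u t) * f t.
Proof.
move=> cu u01; apply: (@funC0E _ _ _ _ 1); first exact: of_real_comp_continuous.
by move=> s; have /andP[u0 u1] := u01 s; rewrite modulus_of_real ger0_norm.
Qed.

Section cutoff_theory.
Variables (u : L -> R) (x : X) (l : {linear X -> K^o}).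
Hypotheses (cu : continuous u) (u01 : forall t, 0 <= u t <= 1).
Hypotheses (x1 : supnorm x <= 1) (l1 : forall f, modulus (l f) <= supnorm f).
Hypothesis lx : l x = 1.

(* x - u x + u f / r lies in the unit ball, on which re l attains its maximum
   at x. *)
Lemma re_cutoff_le (f : X) (r : R) : 0 < r ->
  (forall t, u t != 0 -> modulus (f t) <= r) ->
  re (l (cutoff u f)) <= r * re (l (cutoff u x)).
Proof.
move=> r0 fr; pose g := x - cutoff u x + rc r^-1 *: cutoff u f.
have g1 : supnorm g <= 1.
  apply: supnorm_le => // t; rewrite /g C0DE C0BE C0ZE !cutoffE//.
  rewrite [rc r^-1 * _]mulrCA -{1}[x t]mul1r -mulrBl -of_real1 -of_realB.
  have /andP[u0 u1] := u01 t.
  apply: le_trans (modulusD _ _) _; rewrite !modulusM !modulus_of_real.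
  rewrite ger0_norm ?subr_ge0// [`|u t|]ger0_norm// [`|r^-1|]ger0_norm; last first.
    by rewrite invr_ge0 ltW.
  have xt : modulus (x t) <= 1 by apply: le_trans x1; exact: le_supnorm.
  have [ut|ut] := eqVneq (u t) 0; first by rewrite ut subr0 mul0r addr0 mul1r.
  have : r^-1 * modulus (f t) <= 1 by rewrite mulrC ler_pdivrMr// mul1r fr.
  nra.
have := le_trans (re_scalar_le _) (le_trans (l1 g) g1).
rewrite /g linearD linearB linearZ re_scalarD re_scalarB re_scalarM lx.
rewrite -[in re 1](of_real1 R k) re_of_real -(ler_pM2l r0) mulrDr mulVKf ?gt_eqF//.
rewrite mulr1; lra.
Qed.

Lemma cutoff_ge0 : 0 <= re (l (cutoff u x)).
Proof.
have f0 t : u t != 0 -> modulus ((0 : X) t) <= 1 by rewrite C00E modulus0.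
have := re_cutoff_le ltr01 f0; rewrite mul1r.
suff -> : cutoff u 0 = 0 by rewrite linear0 -{1}(of_real0 R k) re_of_real.
by apply/val_inj/funext => t; rewrite -[LHS]/(cutoff u 0 t) cutoffE// C00E mulr0.
Qed.

(** Plays the part of the identity between the integrals of u d|mu| and of u x dmu for a measure mu
    representing l: after multiplication by u, l still attains its norm at x. *)
Lemma cutoff_functional_bound (f : X) :
  modulus (l (cutoff u f)) <= re (l (cutoff u x)) * supnorm f.
Proof.
have [l' lE] : exists l' : {linear X -> K^o}, forall f, l' f = l (cutoff u f).
  apply: linear_from => a g h; rewrite -linearZ -linearD; congr (l _).
  apply/val_inj/funext => t.
  rewrite -[LHS]/(cutoff u (a *: g + h) t) -[RHS]/(a * cutoff u g t + cutoff u h t).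
  by rewrite !cutoffE// C0DE C0ZE mulrDr mulrCA.
rewrite -lE; apply: functional_bound => {}f f1; rewrite lE.
rewrite -[leRHS]mul1r; apply: re_cutoff_le => // t _.
exact: le_trans (le_supnorm _ _) f1.
Qed.

End cutoff_theory.

Section localization.
Variables (x h : X) (l : {linear X -> K^o}) (v : L -> R) (dl eta b : R).
Hypotheses (cv : continuous v) (v01 : forall t, 0 <= v t <= 1).
Hypotheses (x1 : supnorm x <= 1) (h1 : supnorm h <= 1).
Hypothesis l1 : forall f, modulus (l f) <= supnorm f.
Hypothesis lx : l x = 1.
Hypotheses (dl0 : 0 < dl) (dl1 : dl <= 1).
Hypothesis vdl : forall t, v t != 0 -> re (h t * conj_scalar (x t)) <= 1 - dl.
Hypothesis lh : 1 - eta < re (l h).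
Hypotheses (eta_dl : 2 * eta / dl < 1) (b0 : 0 < b) (b2 : b <= 1 / 2).

Let u t : R := 1 - v t.
Let u01 t : 0 <= u t <= 1.
Proof.
by have /andP[v0 v1] := v01 t; rewrite /u subr_ge0 v1 gerBl.
Qed.
Let cu : continuous u.
Proof. by move=> t; apply: cvgB; [exact: cvg_cst|exact: cv]. Qed.

Let cutoffC f : cutoff u f = f - cutoff v f.
Proof.
apply/val_inj/funext => t; rewrite -[LHS]/(cutoff u f t).
rewrite -[RHS]/(f t - cutoff v f t) !cutoffE//.
by rewrite of_realB of_real1 mulrBl mul1r.
Qed.

Let kappa := re (l (cutoff v x)).

Let re_cutoffC : re (l (cutoff u x)) = 1 - kappa.
Proof.
rewrite cutoffC linearB re_scalarB lx.
by rewrite -[in re 1](of_real1 R k) re_of_real.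
Qed.

(** Where v is nonzero, h and x point in different directions, so |x + dl h| <= N. Hence re l (v h)
    <= (1 - dl / 2) kappa, while re l ((1 - v) h) <= 1 - kappa; so 1 - eta < 1 - dl kappa / 2. *)
Let kappa_le : kappa <= 2 * eta / dl.
Proof.
have dl0' := dl0; have dl1' := dl1; have lh' := lh.
(* A polynomial upper bound for the square root of 1 + 2 dl - dl^2, which is what |x + dl h|^2 is
   bounded by. *)
pose N := 1 + dl - dl ^+ 2 / 2.
have dl2 : 0 <= dl ^+ 2 <= dl by rewrite sqr_ge0 /=; nra.
have N0 : 0 < N by rewrite /N; lra.
have := @re_cutoff_le v x l cv v01 x1 l1 lx (x + rc dl *: h) N N0.
have vxh : cutoff v (x + rc dl *: h) = cutoff v x + rc dl *: cutoff v h.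
  apply/val_inj/funext => t.
  rewrite -[LHS]/(cutoff v (x + rc dl *: h) t).
  rewrite -[RHS]/(cutoff v x t + rc dl * cutoff v h t) !cutoffE//.
  by rewrite C0DE C0ZE mulrDr mulrCA.
rewrite vxh linearD linearZ re_scalarD re_scalarM -/kappa.
have xh t : v t != 0 -> modulus ((x + rc dl *: h) t) <= N.
  move=> vt; rewrite C0DE C0ZE -ler_sqr ?nnegrE ?modulus_ge0 ?(ltW N0)//.
  rewrite modulus_sqrD.
  have ht : modulus (h t) ^+ 2 <= 1.
    by rewrite expr_le1// ?modulus_ge0//; apply: le_trans h1; exact: le_supnorm.
  have xt : modulus (x t) ^+ 2 <= 1.
    by rewrite expr_le1// ?modulus_ge0//; apply: le_trans x1; exact: le_supnorm.
  have hx := vdl vt.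
  have : 2 * dl * re (h t * conj_scalar (x t)) <= 2 * dl * (1 - dl).
    by rewrite ler_wpM2l// mulr_ge0// ltW.
  have : dl ^+ 2 * modulus (h t) ^+ 2 <= dl ^+ 2 * 1 by rewrite ler_wpM2l ?sqr_ge0.
  have : 0 <= (dl - dl ^+ 2 / 2) ^+ 2 by exact: sqr_ge0.
  rewrite /N => ? ? ?.
  have -> : (1 + dl - dl ^+ 2 / 2) ^+ 2 =
    1 + 2 * dl - dl ^+ 2 + (dl - dl ^+ 2 / 2) ^+ 2 by field.
  lra.
move=> /(_ xh) vh.
have := @re_cutoff_le u x l cu u01 x1 l1 lx h 1 ltr01.
rewrite mul1r re_cutoffC cutoffC linearB re_scalarB => /(_ _).
have ht t : u t != 0 -> modulus (h t) <= 1.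
  by move=> _; apply: le_trans h1; exact: le_supnorm.
move=> /(_ ht) uh.
rewrite ler_pdivlMr//.
have vh' : dl * re (l (cutoff v h)) <= dl * ((1 - dl / 2) * kappa).
  by move: vh; rewrite /N; lra.
have : re (l (cutoff v h)) <= (1 - dl / 2) * kappa by rewrite -(ler_pM2l dl0).
lra.
Qed.

Let y := push_to_sphere b x.

(** l' is l (u f) divided by its norm 1 - kappa. Dropping l (v f) and rescaling the rest cost kappa
    each, and 2 kappa <= 4 eta / dl. The last clause expresses that l' lives where v differs from
    1. *)
Lemma localized_functional : exists l' : {linear X -> K^o},
  [/\ forall f, modulus (l' f) <= supnorm f, l' y = 1,
      forall f, modulus (l f - l' f) <= 4 * eta / dl * supnorm f &
      forall (f : X) (a : K), (forall t, v t != 1 -> f t = a * y t) -> l' f = a].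
Proof.
have y1 : supnorm y <= 1 by exact: push_to_sphere_norm.
have yr t : modulus (x t - (y t - x t)) <= 1 by exact: push_to_sphere_reflect.
move: y1 yr; move: (y) => z z1 zr.
have kle := kappa_le; have eta_dl' := eta_dl.
have k0 : 0 <= kappa by exact: cutoff_ge0.
have k1 : 0 < 1 - kappa by lra.
have uF f := cutoff_functional_bound cu u01 x1 l1 lx f.
have [l' lE] : exists l' : {linear X -> K^o},
    forall f, l' f = rc (1 - kappa)^-1 * l (cutoff u f).
  apply: linear_from => a g f.
  have -> : cutoff u (a *: g + f) = a *: cutoff u g + cutoff u f; last first.
    by rewrite linearD linearZ mulrDr; congr (_ + _); rewrite /GRing.scale /= mulrCA.
  apply/val_inj/funext => t.
  rewrite -[LHS]/(cutoff u (a *: g + f) t) -[RHS]/(a * cutoff u g t + cutoff u f t).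
  by rewrite !cutoffE// C0DE C0ZE mulrDr mulrCA.
have l'1 f : modulus (l' f) <= supnorm f.
  rewrite lE modulusM modulus_of_real ger0_norm ?invr_ge0 ?(ltW k1)//.
  by rewrite mulrC ler_pdivrMr// mulrC -re_cutoffC.
have l'z : l' z = 1.
  rewrite -(of_real1 R k); apply: eq_of_real; first exact: le_trans (l'1 _) z1.
  apply/eqP; rewrite eq_le; apply/andP; split.
    exact: le_trans (re_scalar_le _) (le_trans (l'1 _) z1).
  rewrite lE re_scalarM mulrC ler_pdivlMr// mul1r.
  (* Applied to 2 x - y: re l (u (2 x - y)) <= 1 - kappa = re l (u x), which rearranges to re l (u
     y) >= 1 - kappa. *)
  have := @re_cutoff_le u x l cu u01 x1 l1 lx (x - (z - x)) 1 ltr01.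
  have -> : cutoff u (x - (z - x)) = cutoff u x - (cutoff u z - cutoff u x).
    apply/val_inj/funext => t; rewrite -[LHS]/(cutoff u (x - (z - x)) t).
    rewrite -[RHS]/(cutoff u x t - (cutoff u z t - cutoff u x t)).
    by rewrite !cutoffE// !C0BE !mulrBr.
  rewrite mul1r 2!(linearB l) !re_scalarB re_cutoffC => /(_ _).
  have yt t : u t != 0 -> modulus ((x - (z - x)) t) <= 1.
    by move=> _; rewrite !C0BE; exact: zr.
  move=> /(_ yt); lra.
exists l'; split=> // [f|f a fa].
  have -> : l f - l' f =
      l (cutoff v f) + (1 - rc (1 - kappa)^-1) * l (cutoff u f).
    by rewrite lE cutoffC (linearB l) /=; ring.
  have vF := cutoff_functional_bound cv v01 x1 l1 lx f.
  apply: le_trans (modulusD _ _) _.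
  rewrite modulusM -(of_real1 R k) -of_realB modulus_of_real.
  have i1 : 1 <= (1 - kappa)^-1 by rewrite -div1r ler_pdivlMr//; lra.
  rewrite ler0_norm ?subr_le0// opprB.
  have : ((1 - kappa)^-1 - 1) * modulus (l (cutoff u f)) <=
      ((1 - kappa)^-1 - 1) * ((1 - kappa) * supnorm f).
    by rewrite ler_wpM2l ?subr_ge0// -re_cutoffC.
  have -> : ((1 - kappa)^-1 - 1) * ((1 - kappa) * supnorm f) = kappa * supnorm f.
    by field; rewrite gt_eqF.
  have : 2 * kappa * supnorm f <= 4 * eta / dl * supnorm f.
    by rewrite ler_wpM2r ?supnorm_ge0//; lra.
  move: vF; rewrite -/kappa; lra.
suff -> : l' f = a * l' z by rewrite l'z mulr1.
rewrite !lE mulrCA; congr (_ * _).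
have -> : cutoff u f = a *: cutoff u z; last by rewrite linearZ.
apply/val_inj/funext => t; rewrite -[LHS]/(cutoff u f t).
rewrite -[RHS]/(a * cutoff u z t) !cutoffE// mulrCA.
have [vt|/fa ->//] := eqVneq (v t) 1.
by rewrite /u vt subrr of_real0 !mul0r.
Qed.

End localization.
End localized_functionals.

(** * The approximating operator and the theorem *)

Section bishop_phelps_bollobas.
Context (R : realType) (k : scalar_kind) (L : topologicalType).
Local Notation K := (scalars R k).
Local Notation X := (C0 R k L).
Local Notation rc := (@of_real R k).
Local Notation re := (@re_scalar R k).

Lemma of_real_sum (I : Type) (s : seq I) (F : I -> R) :
  rc (\sum_(i <- s) F i) = \sum_(i <- s) rc (F i).
Proof. by apply: (big_morph rc); [exact: of_realD|exact: of_real0]. Qed.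

Lemma totally_bounded_setU1 (B : set X) (x : X) :
  totally_bounded_C0 B -> totally_bounded_C0 (x |` B).
Proof.
move=> tB th th0; have [gs gsB] := tB _ th0; exists (x :: gs) => b [->|/gsB].
  by exists x; rewrite ?mem_head// subrr supnorm0 ltW.
by move=> [g ggs bg]; exists g; rewrite // in_cons ggs orbT.
Qed.

Lemma compact_precompact (B A : set X) : compact A -> B `<=` A -> precompact B.
Proof.
move=> cA BA; apply: (precompact_subset BA); rewrite precompact_closed//.
by apply: compact_closed => //; exact: norm_hausdorff.
Qed.

Lemma contraction_BPB (T : {linear X -> X}) (x : X) (l : {linear X -> K^o})
    (e dl : R) : 0 < e < 1 -> dl = (e / 8) ^+ 2 / 12 ->
  totally_bounded_C0 (T @` [set f | `|f| <= 1]) ->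
  (forall f, supnorm (T f) <= supnorm f) -> Pi_set (x, l) ->
  1 - dl * e / 16 < modulus (l (T x)) ->
  exists (S : {linear X -> X}) (y : X) (g : {linear X -> K^o}),
    [/\ precompact (S @` [set f | `|f| <= 1]), Pi_set (y, g),
        (forall f, supnorm (S f) <= supnorm f) /\ modulus (g (S y)) = 1,
        (forall f, supnorm (T f - S f) <= e / 2 * supnorm f) /\
          supnorm (x - y) <= e / 2 &
        forall f, modulus (l f - g f) <= e / 2 * supnorm f].
Proof.
move=> /andP[e0 e1] dlE tB T1 /PiP[x1 l1 lx] lTx.
pose b := e / 8; pose th := dl / 2.
have b0 : 0 < b by rewrite /b; lra.
have b8 : b <= 1 / 8 by rewrite /b; lra.
have b2 : b <= 1 / 2 by lra.
have dlb : dl = b ^+ 2 / 12 by [].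
have bb : b ^+ 2 <= b / 8 by rewrite expr2; nra.
have bb0 : 0 < b ^+ 2 by rewrite exprn_gt0.
have dl0 : 0 < dl by lra.
have xle : supnorm x <= 1 by rewrite x1.
have xt1 t : modulus (x t) <= 1 by exact: le_trans (le_supnorm _ _) xle.
have [c c1 cE] := exists_rotation (l (T x)).
have ccK : conj_scalar c * c = 1.
  by rewrite mulrC mul_conj_scalar c1 expr1n of_real1.
pose h : X := c *: T x.
have h1 : supnorm h <= 1.
  by rewrite supnormZ c1 mul1r; exact: le_trans (T1 x) xle.
have ht1 t : modulus (h t) <= 1 by exact: le_trans (le_supnorm _ _) h1.
have lh : 1 - dl * e / 16 < re (l h).
  by have -> : l h = c * l (T x); [rewrite /h linearZ|rewrite cE re_of_real].
(* [x] joins the image of the ball so that the partition also controls the oscillation of x, hence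
   of r and y, and sums to 1 where |x| exceeds th. *)
have [s [p [P [PE p0 p1 pB pS]]]] :=
  totally_bounded_partition (totally_bounded_setU1 x tB)
    (divr_gt0 dl0 (ltr0Sn R 1)).
rewrite -/th in pB pS.
have ballT f : supnorm f <= 1 -> (x |` (T @` [set f | `|f| <= 1])) (T f).
  by move=> f1; right; exists f; rewrite //= norm_le1_supnorm.
pose r t := re (h t * conj_scalar (x t)).
have r_le t : r t <= modulus (x t).
  apply: le_trans (re_scalar_le _) _; rewrite modulusM modulus_conj.
  by rewrite -[leRHS]mul1r ler_wpM2r ?modulus_ge0.
have cr : continuous r.
  move=> t; apply: (@continuous_comp _ _ _ (fun t => h t * conj_scalar (x t)) re).
    apply: cvgM; first exact: C0_continuous.
    apply: (@continuous_comp _ _ _ x (@conj_scalar R k)).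
      exact: C0_continuous.
    exact: conj_scalar_continuous.
  exact: re_scalar_continuous.
have rB u t : p u t != 0 -> r t - dl <= r u.
  move=> put.
  have xut : modulus (x t - x u) <= th by apply: pB put _; left.
  have hut : modulus (h t - h u) <= th.
    by rewrite !C0ZE -mulrBr modulusM c1 mul1r; apply: pB put (ballT _ xle).
  rewrite lerBlDr -lerBlDl -re_scalarB.
  have -> : h t * conj_scalar (x t) - h u * conj_scalar (x u) =
    (h t - h u) * conj_scalar (x t) + h u * conj_scalar (x t - x u).
    by rewrite conj_scalarB mulrBl mulrBr addrA subrK.
  apply: le_trans (re_scalar_le _) (le_trans (modulusD _ _) _).
  rewrite (_ : dl = th * 1 + 1 * th); last by rewrite /th; lra.
  by apply: lerD; rewrite modulusM modulus_conj; apply: ler_pM;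
    rewrite ?modulus_ge0.
(* v is 0 where r >= 1 - dl and 1 where r <= 1 - 2 dl, with a linear ramp in r between. *)
pose w t := (1 - dl - r t) / dl.
pose v t := Num.max 0 (Num.min 1 (w t)).
have v01 t : 0 <= v t <= 1.
  by rewrite /v le_max lexx ge_max ler01 ge_min lexx.
have cv : continuous v.
  have cc (a : R) : continuous (fun _ : L => a) by move=> t; exact: cst_continuous.
  have cw : continuous w.
    by move=> t; apply: cvgM; [apply: cvgB; [exact: cc|exact: cr]|exact: cc].
  exact: (continuous_maxr (cc 0) (continuous_minr (cc 1) cw)).
have vdl t : v t != 0 -> r t <= 1 - dl.
  rewrite leNgt; apply: contra_neqN => rt; apply/max_idPl.
  by rewrite ge_min ler_pdivrMr// mul0r subr_le0 (ltW rt) orbT.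
have v1r t : v t != 1 -> 1 - 2 * dl < r t.
  rewrite ltNge; apply: contra_neqN => rt.
  have w1 : 1 <= w t by rewrite ler_pdivlMr//; lra.
  by rewrite /v (min_idPl w1); apply/max_idPr.
pose eta := dl * e / 16.
have etaE : eta / dl = e / 16 by rewrite /eta; field; rewrite gt_eqF.
have eta_dl : 2 * eta / dl < 1 by rewrite -mulrA etaE; lra.
have dl1 : dl <= 1 by lra.
have [g [g1 gy lg gS]] := localized_functional cv v01 xle h1 l1 lx dl0 dl1 vdl lh
  eta_dl b0 b2.
move: gy gS; set y := push_to_sphere b x => gy gS.
have yle : supnorm y <= 1 by exact: push_to_sphere_norm.
have yt1 t : modulus (y t) <= 1 by exact: le_trans (le_supnorm _ _) yle.
have xy t : modulus (x t - y t) <= b by exact: push_to_sphere_dist.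
(* The slack 3 dl makes J contain every node whose weight is nonzero at a point with r > 1 - 2 dl,
   and 3 dl = b ^ 2 / 4 is the slack that [perturbed_functional] accepts. *)
pose J u := 1 - 3 * dl <= r u.
have Jx u : J u -> 1 - b <= modulus (x u).
  by rewrite /J => Ju; apply: le_trans (r_le u); lra.
have Jy u : J u -> modulus (y u) = 1.
  by move=> /Jx xu; exact: push_to_sphere_unit.
have tau_ex u : exists t : {linear X -> K^o},
    forall f, t f = c * conj_scalar (y u) * T f u.
  apply: linear_from => a f1 f2.
  by rewrite linearD linearZ C0DE C0ZE mulrDr mulrCA.
have ev_ex u : exists t : {linear X -> K^o}, forall f, t f = T f u.
  by apply: linear_from => a f1 f2; rewrite linearD linearZ.
have sig_ex u : exists t : {linear X -> K^o},
    (forall f, modulus (t f) <= supnorm f) /\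
    (if J u then t y = 1 /\ forall f,
       modulus (t f - c * conj_scalar (y u) * T f u) <= b * supnorm f
     else forall f, t f = T f u).
  have [Ju|_] := boolP (J u); last first.
    have [t tE] := ev_ex u; exists t; split=> // f; rewrite tE.
    exact: le_trans (le_supnorm _ _) (T1 f).
  have [t tE] := tau_ex u.
  have t1 f : modulus (t f) <= supnorm f.
    rewrite tE !modulusM modulus_conj Jy// c1 !mul1r.
    exact: le_trans (le_supnorm _ _) (T1 f).
  (* r u = m re (h u conj(y u)) with 0 < m <= 1, so passing from x u to y u only increases the real
     part. *)
  have tx : 1 - b ^+ 2 / 4 <= re (t x).
    have -> : t x = h u * conj_scalar (y u) by rewrite tE mulrAC.
    pose m := Num.max (modulus (x u)) (1 - b).
    have mE : r u = m * re (h u * conj_scalar (y u)).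
      rewrite /r (push_to_sphereK b0 b2 xle u) -/y -/m.
      by rewrite conj_scalarM conj_of_real mulrCA re_scalarM.
    have m0 : 0 < m by rewrite lt_max; apply/orP; right; lra.
    have m1 : m <= 1 by rewrite ge_max xt1; lra.
    have := Ju; rewrite /J mE; set q := re _ => mq.
    have mq0 : 0 < m * q by apply: lt_le_trans mq; lra.
    have q0 : 0 < q by rewrite pmulr_rgt0 in mq0.
    have : m * q <= q by rewrite -[leRHS]mul1r ler_wpM2r// ltW.
    lra.
  have [t' [t'1 t'y] t'b] := perturbed_functional b0 b2 xle (Jx _ Ju) t1 tx.
  by exists t'; split=> //; split=> // f; rewrite -tE.
have [sig sigP] := choice sig_ex.
have sig1 u f : modulus (sig u f) <= supnorm f by have [] := sigP u.
(* Rows in J carry the varying factor conj(c) y t, which makes S y proportional to y; the other rows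
   of T are kept. *)
pose om u t : K := if J u then conj_scalar c * y t else 1.
have om1 u t : modulus (om u t) <= 1.
  by rewrite /om; case: ifP; rewrite ?modulus1// modulusM modulus_conj c1 mul1r.
pose V u : X := funC0 (om u) (P u).
have VE u t : u \in s -> V u t = om u t * rc (p u t).
  move=> us; rewrite -PE//; apply: (@funC0E _ _ _ _ 1) => //.
  rewrite /om; case: (J u) => z; last exact: cst_continuous.
  by apply: cvgM; [exact: cvg_cst|exact: C0_continuous].
have [S SE] : exists S : {linear X -> X},
    forall f, S f = \sum_(u <- s) sig u f *: V u.
  apply: linear_from => a f1 f2; rewrite scaler_sumr -big_split /=.
  by apply: eq_bigr => u _; rewrite linearD linearZ scalerDl scalerA.
have SfE f t : S f t = \sum_(u <- s) rc (p u t) * (om u t * sig u f).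
  rewrite SE C0_sumE; apply: eq_big_seq => u us.
  by rewrite C0ZE VE// mulrC mulrAC mulrC.
exists S, y, g.
have S1 f : supnorm (S f) <= supnorm f.
  apply: supnorm_le => [|t]; first exact: supnorm_ge0.
  rewrite SfE; apply: (@le_trans _ _ ((\sum_(u <- s) p u t) * supnorm f)).
    apply: modulus_sum_le => // u us _; rewrite modulusM -[leRHS]mul1r.
    by apply: ler_pM; rewrite ?modulus_ge0.
  by rewrite -[leRHS]mul1r ler_wpM2r ?supnorm_ge0.
split=> //.
- have [A cA As] := finite_rank_precompact s V.
  apply: (compact_precompact cA) => _ [f /= f1 <-]; rewrite SE; apply: As => u _.
  by apply: le_trans (sig1 _ _) _; rewrite -norm_le1_supnorm.
- apply/PiP; split=> //; apply/eqP; rewrite eq_le yle /=.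
  by rewrite -(modulus1 R k) -gy.
(* Where v differs from 1, all active nodes lie in J and the weights sum to 1, so S y = conj(c) y
   there and g (S y) = conj(c). *)
- split=> //; rewrite (gS _ (conj_scalar c)) ?modulus_conj// => t /v1r rt.
  rewrite SfE (eq_big_seq (fun u => rc (p u t) * (conj_scalar c * y t))).
    rewrite -mulr_suml -of_real_sum.
    have [->|/(_ x (or_introl erefl)) xth] := pS t; first by rewrite of_real1 mul1r.
    by exfalso; have := le_trans (r_le t) xth; rewrite /th; lra.
  move=> u us; have [->|put] := eqVneq (p u t) 0; first by rewrite of_real0 !mul0r.
  have Ju : J u by have := rB _ _ put; rewrite /J; lra.
  by have [_] := sigP u; rewrite /om Ju => -[-> _]; rewrite mulr1.
- split; last by apply: supnorm_le => [|t]; [|rewrite C0BE (le_trans (xy t))//];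
    rewrite /b; lra.
  move=> f; have [D DE] : exists D : {linear X -> X}, forall f, D f = T f - S f.
    apply: linear_from => a f1 f2.
    by rewrite !linearD !linearZ /= addrACA.
  rewrite -DE; apply: (unit_ball_bound (N := @supnorm R k L) (F := D)).
  + exact: supnormZ.
  + by move=> a f'; rewrite linearZ.
  move=> {}f f1; rewrite DE; apply: supnorm_le => [|t]; first lra.
  have Tf u : modulus (T f u) <= 1.
    exact: le_trans (le_supnorm _ _) (le_trans (T1 f) f1).
  (* The missing mass of the partition multiplies T f t, which is at most th in modulus unless that
     mass is zero. *)
  have -> : (T f - S f) t = rc (1 - \sum_(u <- s) p u t) * T f t +
      \sum_(u <- s) rc (p u t) * (T f t - om u t * sig u f).
    rewrite (eq_bigr (fun u => rc (p u t) * T f t -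
      rc (p u t) * (om u t * sig u f))) => [|u _]; last by rewrite mulrBr.
    rewrite -[LHS]/(T f t - S f t) SfE big_split /= sumrN -mulr_suml -of_real_sum.
    by rewrite of_realB of_real1; ring.
  have sp0 : 0 <= 1 - \sum_(u <- s) p u t by rewrite subr_ge0.
  have -> : e / 2 = (1 - \sum_(u <- s) p u t) * (e / 2) +
      (\sum_(u <- s) p u t) * (e / 2) by rewrite -mulrDl subrK mul1r.
  apply: le_trans (modulusD _ _) _; apply: lerD.
    rewrite modulusM modulus_of_real ger0_norm//.
    have [->|/(_ _ (ballT _ f1)) Tft] := pS t; first by rewrite subrr !mul0r.
    rewrite ler_wpM2l// (le_trans Tft)// /th; move: dlb bb; rewrite /b; lra.
  apply: modulus_sum_le => // u us put.
  have Tut : modulus (T f t - T f u) <= th by apply: pB put (ballT _ f1).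
  have [_] := sigP u; rewrite /om; have [Ju [_ sb]|_ ->] := ifP; last first.
    by rewrite mul1r (le_trans Tut)// /th; move: dlb bb; rewrite /b; lra.
  (* The three terms are at most th, 2 b + th and b: oscillation of T f, oscillation of y, and the
     change of the row. In all 3 e / 8 + dl, below e / 2. *)
  have -> : T f t - conj_scalar c * y t * sig u f = (T f t - T f u) +
      T f u * ((y u - y t) * conj_scalar (y u)) -
      conj_scalar c * y t * (sig u f - c * conj_scalar (y u) * T f u).
    have yy : y u * conj_scalar (y u) = 1.
      by rewrite mul_conj_scalar Jy// expr1n of_real1.
    transitivity (T f t - conj_scalar c * y t * sig u f +
        T f u * (y u * conj_scalar (y u) - 1) +
        (conj_scalar c * c - 1) * (y t * conj_scalar (y u) * T f u)).
      by rewrite yy ccK !subrr mulr0 mul0r !addr0.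
    ring.
  have xtu : modulus (x t - x u) <= th by apply: pB put _; left.
  have yut : modulus (y u - y t) <= 2 * b + th.
    have := modulusD (y u - x u) (x u - x t); have := modulusD (y u - x t) (x t - y t).
    have := xy t; have := xy u; move: xtu.
    by rewrite !addrA !subrK modulusBC [modulus (x u - y u)]modulusBC; lra.
  apply: le_trans (modulusD _ _) _; rewrite modulusN.
  have := modulusD (T f t - T f u) (T f u * ((y u - y t) * conj_scalar (y u))).
  rewrite !modulusM !modulus_conj c1 mul1r Jy// mulr1.
  have : modulus (T f u) * modulus (y u - y t) <= 1 * (2 * b + th).
    by apply: ler_pM; rewrite ?modulus_ge0.
  have : modulus (y t) * modulus (sig u f - c * conj_scalar (y u) * T f u) <= 1 * b.
    apply: ler_pM; rewrite ?modulus_ge0//; apply: le_trans (sb f) _.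
    by rewrite -[leRHS]mulr1 ler_wpM2l// ltW.
  move: Tut dlb bb; rewrite /th /b; lra.
- move=> f; apply: le_trans (lg f) _; rewrite ler_wpM2r ?supnorm_ge0//.
  by rewrite -mulrA etaE; lra.
Qed.

End bishop_phelps_bollobas.

Theorem theorem1p6 (R : realType) (k : scalar_kind) (L : topologicalType)
    (hausdorffL : hausdorff_space L)
    (locally_compactL : locally_compact [set: L]%classic) :
  BPBp_nu_compact (C0 R k L).
Proof.
move=> eps /andP[eps0 eps1]; pose e : R := re_scalar eps.
have epsE : of_real k e = eps by rewrite /e of_re_scalar// ltW.
have e0 : 0 < e by rewrite -(lt_of_real k) of_real0 epsE.
have e1 : e < 1 by rewrite -(lt_of_real k) of_real1 epsE.
pose dl : R := (e / 8) ^+ 2 / 12.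
have dl01 : 0 < dl < 1.
  have : 0 < (e / 8) ^+ 2 by rewrite exprn_gt0//; lra.
  have : (e / 8) ^+ 2 < 1 by rewrite expr_lt1//; lra.
  by rewrite /dl => ? ?; apply/andP; split; lra.
have /andP[dl0 dl1] := dl01.
exists (of_real k (dl * e / 16)).
  rewrite -(of_real0 R k) -(of_real1 R k) !lt_of_real.
  by apply/andP; split; nra.
move=> T x f cT Pxf nuT fTx.
have tB := precompact_totally_bounded cT.
(* This crude bound makes the numerical radius a true supremum; numerical index one then improves it
   to 1. *)
have [M M0 TM] := totally_bounded_bounded tB.
have TMb g : supnorm (T g) <= M * supnorm g.
  apply: (unit_ball_bound (N := @supnorm R k L) (F := T)) => [||{}g g1].
  - exact: supnormZ.
  - by move=> a h; rewrite linearZ.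
  - by apply: TM; exists g; rewrite //= norm_le1_supnorm.
have T1 : forall g, supnorm (T g) <= supnorm g.
  apply: (numerical_radius_norm TMb) => p Pp.
  exact: (numerical_radius_ub TMb).
have fTx' : 1 - dl * e / 16 < modulus (f (T x)).
  by rewrite -(lt_of_real k) of_realB of_real1 of_real_modulus.
have e01 : 0 < e < 1 by rewrite e0.
have [S [y [g [cS Pyg [S1 gSy] [TS xy] fg]]]] :=
  contraction_BPB e01 erefl tB T1 Pxf fTx'.
(* The bounds by e / 2 are not strict; the other half gives the strict inequalities required. *)
have half : of_real k (e / 2) < eps by rewrite -epsE lt_of_real; lra.
have e20 : 0 <= e / 2 by lra.
exists S, y, g; split=> //.
- split; last by rewrite -of_real_modulus gSy of_real1.
  exact: (numerical_radius1 S1 Pyg).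
- apply: le_lt_trans half; apply: opnorm_le => h h1.
  rewrite norm_le_supnorm (le_trans (TS h))// -[leRHS]mulr1 ler_wpM2l//.
  by rewrite -norm_le1_supnorm.
- by apply: le_lt_trans half; rewrite norm_le_supnorm.
- apply: le_lt_trans half; apply: opnorm_le => h h1.
  rewrite -of_real_modulus le_of_real (le_trans (fg h))// -[leRHS]mulr1.
  by rewrite ler_wpM2l// -norm_le1_supnorm.
Qed.
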